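(* Let $T$ be the max-plus quasi-field of reals, and let $P,Q\in T\{X_1,\dots,X_n\}$. Then $V(P)\subset V(Q)$ if and only if $P$ divides some power $Q^k$ ($k\ge1$) in $T\{X_1,\dots,X_n\}$.
   Context: $T$ is $\mathbb R_{\ge0}$ with addition $u+v=\max(u,v)$ and usual multiplication (isomorphic to $\mathbb R\cup\{-\infty\}$ with $\max$ and $+$); it is a totally ordered quasi-field of characteristic $1$. $T\{X_1,\dots,X_n\}$ is the image of $T[X_1,\dots,X_n]$ in its quasi-field of fractions, i.e. the quotient by $P\sim Q$ iff $RP=RQ$ for some nonzero $R$ (rational polynomials). A point $x\in T^n$ is a zero of a polynomial $P$ if $P(x)=0$ or the maximum of the values at $x$ of the monomials of $P$ is attained by at least two distinct monomials; this does not depend on the representative, so it defines zeros of rational polynomials. $V(P)\subset T^n$ is the set of zeros of $P$. $P$ divides $S$ means $S=PR$ for some $R\in T\{X_1,\dots,X_n\}$. *)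

(* Defs.v *)
(* tropical (max-times) polynomials over T = R_{>=0}. *)
From Stdlib Require Import Reals List Arith.
Import ListNotations.
Open Scope R_scope.

Definition expo := list nat.

(* A polynomial of T[X_1..X_n] is represented by a finite list of terms
   (coefficient, exponent).  Repeated exponents are allowed: since addition
   in T is max, the coefficient of X^alpha is the max of the coefficients of
   the terms with exponent alpha ([coef] below).  Coefficients lie in T. *)
Definition tpoly := list (R * expo).

Definition wf (n : nat) (P : tpoly) : Prop :=
  Forall (fun m => 0 <= fst m /\ length (snd m) = n) P.

Definition expo_eqb (a b : expo) : bool :=
  if list_eq_dec Nat.eq_dec a b then true else false.

Definition coef (P : tpoly) (alpha : expo) : R :=
  fold_right Rmax 0 (map fst (filter (fun m => expo_eqb (snd m) alpha) P)).

Definition peq (P Q : tpoly) : Prop := forall alpha, coef P alpha = coef Q alpha.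

Definition pnz (P : tpoly) : Prop := exists alpha, coef P alpha <> 0.

Fixpoint addexp (a b : expo) : expo :=
  match a, b with
  | e :: a', f :: b' => (e + f)%nat :: addexp a' b'
  | _, _ => []
  end.

Definition pmul (P Q : tpoly) : tpoly :=
  flat_map (fun m1 => map (fun m2 => (fst m1 * fst m2, addexp (snd m1) (snd m2))) Q) P.

Definition pone (n : nat) : tpoly := [(1, repeat 0%nat n)].

Fixpoint ppow (n : nat) (P : tpoly) (k : nat) : tpoly :=
  match k with
  | O => pone n
  | S k' => pmul P (ppow n P k')
  end.

Fixpoint monoval_from (i : nat) (x : nat -> R) (alpha : expo) : R :=
  match alpha with
  | [] => 1
  | e :: a' => (x i ^ e) * monoval_from (S i) x a'
  end.
Definition monoval (x : nat -> R) (alpha : expo) : R := monoval_from 0 x alpha.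

Definition termval (x : nat -> R) (m : R * expo) : R := fst m * monoval x (snd m).

Definition peval (P : tpoly) (x : nat -> R) : R :=
  fold_right Rmax 0 (map (termval x) P).

Definition inTn (n : nat) (x : nat -> R) : Prop := forall i, (i < n)%nat -> 0 <= x i.

Definition is_zero (P : tpoly) (x : nat -> R) : Prop :=
  peval P x = 0 \/
  exists m1 m2, In m1 P /\ In m2 P /\ snd m1 <> snd m2 /\
    termval x m1 = peval P x /\ termval x m2 = peval P x.

Definition Vsub (n : nat) (P Q : tpoly) : Prop :=
  forall x, inTn n x -> is_zero P x -> is_zero Q x.

(* P divides S in T{X_1..X_n}: [S] = [P][R] for some R, i.e. U*S = U*(P*R)
   in T[X_1..X_n] for some nonzero U. *)
Definition tdivides (n : nat) (P S : tpoly) : Prop :=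
  exists R, wf n R /\ exists U, wf n U /\ pnz U /\ peq (pmul U S) (pmul U (pmul P R)).

(* Main.v *)
(* In logarithmic coordinates a tropical polynomial is a maximum of affine functions
   with integral slopes, and its zeros are the kinks of this function; equality in
   T{X_1..X_n} turns out to be equality of functions.

   If Q^k = P R, a kink of P is a kink of P R because log R is convex, hence a kink of Q.

   Conversely, discard the redundant terms of Q.  On the open cell where a term q
   dominates, Q has no zero, hence neither has P, and by convexity of the cell a single
   term p of P dominates there.  A Farkas-type argument gives P q^k <= p Q^k everywhere
   for large k, and zeros with a vanishing coordinate show that q^k / p has nonnegative
   exponents.  The maximum R of these quotients satisfies P R = Q^k as functions.

   Finally, if a term m is below the function F, Farkas gives N with m^N <= F^N
   coefficientwise, and then U = (m + F)^(N-1) satisfies U m <= U F; this makes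
   functions separate the elements of T{X_1..X_n}. *)
Require Import Defs.
From Stdlib Require Import Reals List Arith ZArith Lra Lia Classical Permutation.
Import ListNotations.
Open Scope R_scope.

(** * Gordan's alternative with integral linear parts *)

Definition sumR {A : Type} (f : A -> R) (L : list A) : R :=
  fold_right (fun a s => f a + s) 0 L.

Definition sumZ {A : Type} (v : A -> nat -> Z) (L : list A) (i : nat) : Z :=
  fold_right (fun a s => (v a i + s)%Z) 0%Z L.

Fixpoint dot (n : nat) (v : nat -> Z) (y : nat -> R) : R :=
  match n with
  | O => 0
  | S n' => IZR (v O) * y O + dot n' (fun i => v (S i)) (fun i => y (S i))
  end.

Lemma sumR_app {A} (f : A -> R) L M : sumR f (L ++ M) = sumR f L + sumR f M.
Proof. induction L as [|a L IH]; simpl; [lra|]. unfold sumR in *. simpl. rewrite IH. lra. Qed.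

Lemma sumR_concat {A} (f : A -> R) (LL : list (list A)) :
  sumR f (concat LL) = sumR (sumR f) LL.
Proof. induction LL as [|L LL IH]; [reflexivity|]. simpl. now rewrite sumR_app, IH. Qed.

Lemma sumR_repeat {A} (f : A -> R) a k : sumR f (repeat a k) = INR k * f a.
Proof.
  induction k as [|k IH]; [simpl; lra|].
  rewrite S_INR. simpl. rewrite IH. lra.
Qed.

Lemma sumR_plus {A} (f g : A -> R) L :
  sumR (fun a => f a + g a) L = sumR f L + sumR g L.
Proof. induction L as [|a L IH]; simpl; [lra|]. rewrite IH. lra. Qed.

Lemma sumR_ext {A} (f g : A -> R) L : (forall a, In a L -> f a = g a) -> sumR f L = sumR g L.
Proof.
  induction L as [|a L IH]; intros H; [reflexivity|]. simpl.
  rewrite H by now left. rewrite IH; [reflexivity|]. intros; apply H; now right.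
Qed.

Lemma sumZ_app {A} (v : A -> nat -> Z) L M i :
  sumZ v (L ++ M) i = (sumZ v L i + sumZ v M i)%Z.
Proof. induction L as [|a L IH]; simpl; [lia|]. rewrite IH. lia. Qed.

Lemma sumZ_concat {A} (v : A -> nat -> Z) (LL : list (list A)) i :
  sumZ v (concat LL) i = sumZ (sumZ v) LL i.
Proof. induction LL as [|L LL IH]; [reflexivity|]. simpl. now rewrite sumZ_app, IH. Qed.

Lemma sumZ_repeat {A} (v : A -> nat -> Z) a k i :
  sumZ v (repeat a k) i = (Z.of_nat k * v a i)%Z.
Proof. induction k as [|k IH]; [simpl; lia|]. rewrite Nat2Z.inj_succ. simpl. rewrite IH. lia. Qed.

Lemma dot_ext n v w y u :
  (forall i, (i < n)%nat -> v i = w i) -> (forall i, (i < n)%nat -> y i = u i) ->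
  dot n v y = dot n w u.
Proof.
  revert v w y u. induction n as [|n IH]; intros v w y u Hv Hy; [reflexivity|]. simpl.
  rewrite (Hv O), (Hy O) by lia. f_equal. apply IH; intros; [apply Hv|apply Hy]; lia.
Qed.

Lemma dot_0 n y : dot n (fun _ => 0%Z) y = 0.
Proof. revert y. induction n as [|n IH]; intros y; simpl; [lra|]. rewrite IH. lra. Qed.

Lemma dot_plus n v w y : dot n (fun i => (v i + w i)%Z) y = dot n v y + dot n w y.
Proof.
  revert v w y. induction n as [|n IH]; intros v w y; simpl; [lra|].
  rewrite (IH (fun i => v (S i)) (fun i => w (S i))), plus_IZR. lra.
Qed.

Lemma dot_minus n v w y : dot n (fun i => (v i - w i)%Z) y = dot n v y - dot n w y.
Proof.
  revert v w y. induction n as [|n IH]; intros v w y; simpl; [lra|].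
  rewrite (IH (fun i => v (S i)) (fun i => w (S i))), minus_IZR. lra.
Qed.

Lemma dot_comb n v y u s t :
  dot n v (fun i => s * y i + t * u i) = s * dot n v y + t * dot n v u.
Proof.
  revert v y u. induction n as [|n IH]; intros v y u; simpl; [lra|].
  rewrite (IH (fun i => v (S i)) (fun i => y (S i)) (fun i => u (S i))). lra.
Qed.

Lemma dot_sumZ {A} n (v : A -> nat -> Z) L y :
  dot n (sumZ v L) y = sumR (fun a => dot n (v a) y) L.
Proof.
  induction L as [|a L IH]; simpl.
  - apply dot_0.
  - rewrite <- IH. apply (dot_plus n (v a) (sumZ v L)).
Qed.

Lemma upper_bound_below (l : list R) (b : R) :
  (forall a, In a l -> a < b) -> exists c, c < b /\ forall a, In a l -> a < c.
Proof.
  induction l as [|a l IH]; intros H.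
  - exists (b - 1). split; [lra|]. intros a [].
  - destruct IH as [c [Hc Hl]]; [intros; apply H; now right|].
    assert (Ha := H a (or_introl eq_refl)).
    exists (Rmax c ((a + b) / 2)). split.
    + apply Rmax_lub_lt; lra.
    + intros d [->|Hd].
      * eapply Rlt_le_trans; [|apply Rmax_r]. lra.
      * eapply Rlt_le_trans; [|apply Rmax_l]. now apply Hl.
Qed.

(** Back-substitution for the elimination: the eliminated variable must lie strictly between
    finitely many lower and upper bounds. Strictness leaves room to lower the choice each time a new
    upper bound is added. *)
Lemma separate_lists (l u : list R) :
  (forall a b, In a l -> In b u -> a < b) ->
  exists c, (forall a, In a l -> a < c) /\ (forall b, In b u -> c < b).
Proof.
  induction u as [|b u IH]; intros H.
  - destruct (upper_bound_below l (fold_right Rmax 0 l + 1)) as [c [_ Hc]].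
    + intros a Ha. clear H. induction l as [|d l IH]; [destruct Ha|]. simpl.
      destruct Ha as [->|Ha].
      * generalize (Rmax_l a (fold_right Rmax 0 l)). lra.
      * specialize (IH Ha). generalize (Rmax_r d (fold_right Rmax 0 l)). lra.
    + exists c. split; [exact Hc|]. intros b [].
  - destruct IH as [c [Hl Hu]]; [intros; apply H; simpl; auto|].
    destruct (upper_bound_below l (Rmin b c)) as [d [Hd Hld]].
    { intros a Ha. apply Rmin_glb_lt; [apply H; simpl; auto|now apply Hl]. }
    exists d. split; [exact Hld|]. intros e [->|He].
    + generalize (Rmin_l e c). lra.
    + generalize (Rmin_r b c) (Hu e He). lra.
Qed.

(* Gordan's alternative by Fourier-Motzkin elimination.  The multipliers are
   natural numbers because the linear parts are integral; they are recorded as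
   the multiplicities in [L], so that combining combinations is [concat]. *)
Theorem gordan (n : nat) : forall (A : Type) (v : A -> nat -> Z) (l : A -> R) (rows : list A),
  (exists y, forall a, In a rows -> dot n (v a) y + l a < 0) \/
  (exists L, L <> [] /\ incl L rows /\ (forall i, (i < n)%nat -> sumZ v L i = 0%Z) /\
     0 <= sumR l L).
Proof.
  induction n as [|n IH]; intros A v l rows.
  - destruct (classic (exists a, In a rows /\ 0 <= l a)) as [[a [Ha Hl]]|H].
    + right. exists [a]. repeat split.
      * discriminate.
      * intros b [->|[]]; exact Ha.
      * lia.
      * simpl; lra.
    + left. exists (fun _ => 0). intros a Ha. simpl.
      destruct (Rlt_le_dec (l a) 0); [lra|]. exfalso. apply H. eauto.
  - set (zer := filter (fun a => Z.eqb (v a O) 0) rows).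
    set (pos := filter (fun a => Z.ltb 0 (v a O)) rows).
    set (neg := filter (fun a => Z.ltb (v a O) 0) rows).
    (* For [a] in [pos] and [b] in [neg] both multiplicities are positive, and the leading
       coefficients cancel in the sum. *)
    set (comb := fun a b => repeat a (Z.to_nat (- v b O)) ++ repeat b (Z.to_nat (v a O))).
    set (rows' := map (fun a => [a]) zer ++ flat_map (fun a => map (comb a) neg) pos).
    assert (Hpos : forall a, In a pos <-> In a rows /\ (0 < v a O)%Z).
    { intros a. unfold pos. rewrite filter_In, Z.ltb_lt. tauto. }
    assert (Hneg : forall a, In a neg <-> In a rows /\ (v a O < 0)%Z).
    { intros a. unfold neg. rewrite filter_In, Z.ltb_lt. tauto. }
    assert (Hzer : forall a, In a zer <-> In a rows /\ v a O = 0%Z).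
    { intros a. unfold zer. rewrite filter_In, Z.eqb_eq. tauto. }
    assert (Hrows : forall L, In L rows' <-> (exists a, In a zer /\ L = [a]) \/
              (exists a b, In a pos /\ In b neg /\ L = comb a b)).
    { intros L. unfold rows'. rewrite in_app_iff, in_map_iff, in_flat_map.
      setoid_rewrite in_map_iff. firstorder (subst; eauto 10). }
    destruct (IH (list A) (fun L i => sumZ v L (S i)) (sumR l) rows')
      as [[y Hy]|[LL [Hnil [Hincl [HZ Hl]]]]].
    + left.
      set (val := fun a => dot n (fun i => v a (S i)) y + l a).
      assert (Hval : forall L, In L rows' -> sumR val L < 0).
      { intros L HL. specialize (Hy L HL). unfold val. rewrite sumR_plus.
        rewrite <- (dot_sumZ n (fun a i => v a (S i)) L y). exact Hy. }
      (* Rows of [neg] bound the first coordinate from below, rows of [pos] from above. The row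
         [comb a b], negative at [y], says exactly that the two bounds of the pair are
         compatible. *)
      destruct (separate_lists (map (fun b => val b / IZR (- v b O)) neg)
                               (map (fun a => - val a / IZR (v a O)) pos)) as [c [Hc1 Hc2]].
      { intros p q Hp Hq. apply in_map_iff in Hp. apply in_map_iff in Hq.
        destruct Hp as [b [<- Hb]], Hq as [a [<- Ha]].
        assert (Hab := Hval (comb a b)
          (proj2 (Hrows _) (or_intror (ex_intro _ a (ex_intro _ b (conj Ha (conj Hb eq_refl))))))).
        unfold comb in Hab. rewrite sumR_app, !sumR_repeat in Hab.
        apply Hpos in Ha. apply Hneg in Hb. destruct Ha as [_ Ha], Hb as [_ Hb].
        rewrite !INR_IZR_INZ, !Z2Nat.id in Hab by lia.
        assert (Ha' : 0 < IZR (v a O)) by (apply IZR_lt; lia).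
        assert (Hb' : 0 < IZR (- v b O)) by (apply IZR_lt; lia).
        apply (Rmult_lt_reg_r (IZR (- v b O) * IZR (v a O))); [nra|].
        replace (val b / IZR (- v b O) * (IZR (- v b O) * IZR (v a O)))
          with (IZR (v a O) * val b) by (field; lra).
        replace (- val a / IZR (v a O) * (IZR (- v b O) * IZR (v a O)))
          with (- (IZR (- v b O) * val a)) by (field; lra).
        lra. }
      exists (fun i => match i with O => c | S i' => y i' end).
      intros a Ha. simpl. fold (val a).
      change (IZR (v a O) * c + dot n (fun i => v a (S i)) y + l a < 0).
      assert (E : IZR (v a O) * c + dot n (fun i => v a (S i)) y + l a
                  = IZR (v a O) * c + val a) by (unfold val; lra).
      rewrite E. clear E.
      destruct (Z.lt_trichotomy (v a O) 0) as [H|[H|H]].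
      * assert (Hb : In a neg) by (apply Hneg; auto).
        specialize (Hc1 _ (in_map (fun b => val b / IZR (- v b O)) _ _ Hb)).
        simpl in Hc1.
        assert (Hb' : 0 < IZR (- v a O)) by (apply IZR_lt; lia).
        apply (Rmult_lt_compat_r _ _ _ Hb') in Hc1.
        replace (val a / IZR (- v a O) * IZR (- v a O)) with (val a) in Hc1 by (field; lra).
        rewrite opp_IZR in Hc1. lra.
      * assert (Hb : In [a] rows').
        { apply Hrows. left. exists a. split; [apply Hzer; auto|reflexivity]. }
        apply Hval in Hb. simpl in Hb. rewrite H. lra.
      * assert (Hb : In a pos) by (apply Hpos; auto).
        specialize (Hc2 _ (in_map (fun b => - val b / IZR (v b O)) _ _ Hb)).
        simpl in Hc2.
        assert (Hb' : 0 < IZR (v a O)) by (apply IZR_lt; lia).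
        apply (Rmult_lt_compat_r _ _ _ Hb') in Hc2.
        replace (- val a / IZR (v a O) * IZR (v a O)) with (- val a) in Hc2 by (field; lra).
        lra.
    (* Every reduced row is itself a nonempty list of original rows whose leading coefficients sum
       to zero, so flattening also kills the first coordinate. *)
    + right. exists (concat LL).
      assert (Hrow0 : forall L, In L rows' -> L <> [] /\ incl L rows /\ sumZ v L O = 0%Z).
      { intros L HL. apply Hrows in HL.
        destruct HL as [[a [Ha ->]]|[a [b [Ha [Hb ->]]]]].
        - apply Hzer in Ha. repeat split.
          + discriminate.
          + intros b [->|[]]; tauto.
          + simpl. lia.
        - apply Hpos in Ha. apply Hneg in Hb. unfold comb. repeat split.
          + destruct (Z.to_nat (- v b O)) eqn:E; [lia|discriminate].
          + intros c Hc. apply in_app_iff in Hc.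
            destruct Hc as [Hc|Hc]; apply repeat_spec in Hc; subst; tauto.
          + rewrite sumZ_app, !sumZ_repeat, !Z2Nat.id by lia. lia. }
      repeat split.
      * destruct LL as [|L LL]; [congruence|]. simpl. intros E.
        apply app_eq_nil in E. destruct E as [E _].
        destruct (Hrow0 L) as [H _]; [apply Hincl; now left|]. congruence.
      * intros a Ha. apply in_concat in Ha. destruct Ha as [L [HL Ha]].
        apply (Hrow0 L); auto.
      * intros [|i] Hi.
        -- rewrite sumZ_concat. clear Hnil HZ Hl.
           induction LL as [|L LL IHL]; [reflexivity|]. simpl.
           rewrite IHL by (intros x Hx; apply Hincl; now right).
           destruct (Hrow0 L) as [_ [_ H]]; [apply Hincl; now left|]. lia.
        -- rewrite sumZ_concat. rewrite <- (HZ i) by lia. clear.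
           induction LL as [|L LL IHL]; [reflexivity|]. simpl. now rewrite IHL.
      * now rewrite sumR_concat.
Qed.

(** * Terms and evaluation *)

Definition wfterm (n : nat) (m : R * expo) : Prop := 0 <= fst m /\ length (snd m) = n.

Definition inTpos (n : nat) (x : nat -> R) : Prop := forall i, (i < n)%nat -> 0 < x i.

Lemma inTpos_inTn n x : inTpos n x -> inTn n x.
Proof. intros H i Hi. left. auto. Qed.

Lemma wf_In n P m : wf n P -> In m P -> wfterm n m.
Proof. intros H. revert m. now apply Forall_forall. Qed.

Lemma maxlist_nonneg (l : list R) : 0 <= fold_right Rmax 0 l.
Proof. induction l; simpl; [lra|]. eapply Rle_trans; [eassumption|apply Rmax_r]. Qed.

Lemma maxlist_ub (l : list R) a : In a l -> a <= fold_right Rmax 0 l.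
Proof.
  induction l as [|b l IH]; simpl; [tauto|]. intros [->|H]; [apply Rmax_l|].
  eapply Rle_trans; [apply IH, H|apply Rmax_r].
Qed.

Lemma maxlist_lub (l : list R) c :
  0 <= c -> (forall a, In a l -> a <= c) -> fold_right Rmax 0 l <= c.
Proof. intros Hc. induction l as [|b l IH]; simpl; [auto|]. intros H. apply Rmax_lub; auto. Qed.

Lemma maxlist_attained (l : list R) :
  0 < fold_right Rmax 0 l -> In (fold_right Rmax 0 l) l.
Proof.
  induction l as [|b l IH]; simpl; [lra|].
  apply Rmax_case; auto.
Qed.

Lemma peval_nonneg P x : 0 <= peval P x.
Proof. apply maxlist_nonneg. Qed.

Lemma peval_ub P x m : In m P -> termval x m <= peval P x.
Proof. intros H. apply maxlist_ub. now apply in_map. Qed.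

Lemma peval_lub P x c :
  0 <= c -> (forall m, In m P -> termval x m <= c) -> peval P x <= c.
Proof.
  intros Hc H. apply maxlist_lub; [exact Hc|].
  intros a Ha. apply in_map_iff in Ha. destruct Ha as [m [<- Hm]]. auto.
Qed.

Lemma peval_attained P x : 0 < peval P x -> exists m, In m P /\ termval x m = peval P x.
Proof.
  intros H. apply maxlist_attained in H. apply in_map_iff in H.
  destruct H as [m [E Hm]]. eauto.
Qed.

Lemma peval_incl P Q x : incl P Q -> peval P x <= peval Q x.
Proof. intros H. apply peval_lub; [apply peval_nonneg|]. intros m Hm. apply peval_ub. auto. Qed.

Lemma In_filter_expo (P : tpoly) a m :
  In m (filter (fun m : R * expo => expo_eqb (snd m) a) P) <-> In m P /\ snd m = a.
Proof.
  rewrite filter_In. unfold expo_eqb.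
  destruct (list_eq_dec Nat.eq_dec (snd m) a); intuition congruence.
Qed.

Lemma coef_nonneg P a : 0 <= coef P a.
Proof. apply maxlist_nonneg. Qed.

Lemma coef_ub P m : In m P -> fst m <= coef P (snd m).
Proof. intros H. apply maxlist_ub, in_map, In_filter_expo. auto. Qed.

Lemma coef_attained P a :
  0 < coef P a -> exists m, In m P /\ snd m = a /\ fst m = coef P a.
Proof.
  intros H. apply maxlist_attained in H. apply in_map_iff in H.
  destruct H as [m [E Hm]]. apply In_filter_expo in Hm. exists m. tauto.
Qed.

Lemma monoval_from_nonneg a : forall i x,
  (forall j, (i <= j < i + length a)%nat -> 0 <= x j) -> 0 <= monoval_from i x a.
Proof.
  induction a as [|e a IH]; intros i x H; simpl in *; [lra|].
  apply Rmult_le_pos; [apply pow_le, H; lia|]. apply IH. intros; apply H; lia.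
Qed.

Lemma monoval_nonneg n x a : inTn n x -> length a = n -> 0 <= monoval x a.
Proof. intros H E. apply monoval_from_nonneg. intros; apply H; lia. Qed.

Lemma termval_nonneg n x m : inTn n x -> wfterm n m -> 0 <= termval x m.
Proof. intros Hx [H E]. apply Rmult_le_pos; [exact H|]. now apply (monoval_nonneg n). Qed.

Lemma monoval_from_addexp a : forall b i x, length a = length b ->
  monoval_from i x (addexp a b) = monoval_from i x a * monoval_from i x b.
Proof.
  induction a as [|e a IH]; intros [|f b] i x H; simpl in *; try lia; [lra|].
  rewrite IH by lia. rewrite pow_add. ring.
Qed.

Lemma length_addexp n a b : length a = n -> length b = n -> length (addexp a b) = n.
Proof.
  revert n b. induction a as [|e a IH]; intros n [|f b]; simpl; try lia.
  destruct n; intros; [lia|]. f_equal. apply IH; lia.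
Qed.

Definition tmul (m1 m2 : R * expo) : R * expo := (fst m1 * fst m2, addexp (snd m1) (snd m2)).

Lemma tmul_wf n m1 m2 : wfterm n m1 -> wfterm n m2 -> wfterm n (tmul m1 m2).
Proof.
  intros [A1 B1] [A2 B2]. split; simpl; [now apply Rmult_le_pos|now apply length_addexp].
Qed.

Lemma termval_tmul n x m1 m2 : wfterm n m1 -> wfterm n m2 ->
  termval x (tmul m1 m2) = termval x m1 * termval x m2.
Proof.
  intros [_ E1] [_ E2]. unfold termval, tmul, monoval. simpl.
  rewrite monoval_from_addexp by exact (eq_trans E1 (eq_sym E2)). ring.
Qed.

Lemma In_pmul P Q m :
  In m (pmul P Q) <-> exists m1 m2, In m1 P /\ In m2 Q /\ m = tmul m1 m2.
Proof.
  unfold pmul. rewrite in_flat_map. split.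
  - intros [m1 [H1 H]]. apply in_map_iff in H. destruct H as [m2 [E H2]]. exists m1, m2. auto.
  - intros [m1 [m2 [H1 [H2 E]]]]. exists m1. split; [exact H1|].
    apply in_map_iff. exists m2. auto.
Qed.

Lemma wf_pmul n P Q : wf n P -> wf n Q -> wf n (pmul P Q).
Proof.
  intros HP HQ. apply Forall_forall. intros m Hm. apply In_pmul in Hm.
  destruct Hm as [m1 [m2 [H1 [H2 ->]]]]. apply tmul_wf; [exact (wf_In _ _ _ HP H1)|exact (wf_In _ _ _ HQ H2)].
Qed.

Lemma wf_pone n : wf n (pone n).
Proof. constructor; [|constructor]. simpl. rewrite repeat_length. split; [lra|auto]. Qed.

Lemma wf_ppow n P k : wf n P -> wf n (ppow n P k).
Proof. intros HP. induction k; simpl; [apply wf_pone|now apply wf_pmul]. Qed.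

Lemma peval_pmul n P Q x : inTn n x -> wf n P -> wf n Q ->
  peval (pmul P Q) x = peval P x * peval Q x.
Proof.
  intros Hx HP HQ. assert (NP := peval_nonneg P x). assert (NQ := peval_nonneg Q x).
  apply Rle_antisym.
  - apply peval_lub; [now apply Rmult_le_pos|].
    intros m Hm. apply In_pmul in Hm. destruct Hm as [m1 [m2 [H1 [H2 ->]]]].
    assert (W1 := wf_In _ _ _ HP H1). assert (W2 := wf_In _ _ _ HQ H2).
    rewrite (termval_tmul n) by auto.
    apply Rmult_le_compat; try (apply (termval_nonneg n); auto); now apply peval_ub.
  - destruct (Req_dec (peval P x) 0) as [E|E];
      [rewrite E, Rmult_0_l; apply peval_nonneg|].
    destruct (Req_dec (peval Q x) 0) as [E'|E'];
      [rewrite E', Rmult_0_r; apply peval_nonneg|].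
    destruct (peval_attained P x) as [m1 [H1 <-]]; [lra|].
    destruct (peval_attained Q x) as [m2 [H2 <-]]; [lra|].
    rewrite <- (termval_tmul n); [|exact (wf_In _ _ _ HP H1)|exact (wf_In _ _ _ HQ H2)].
    apply peval_ub, In_pmul. eauto.
Qed.

Lemma monoval_from_zero k : forall i x, monoval_from i x (repeat 0%nat k) = 1.
Proof. induction k as [|k IH]; intros; simpl; [lra|]. rewrite IH. lra. Qed.

Lemma peval_pone n x : peval (pone n) x = 1.
Proof.
  unfold peval, pone, termval, monoval. simpl. rewrite monoval_from_zero.
  rewrite Rmax_left; lra.
Qed.

Lemma peval_ppow n P k x : inTn n x -> wf n P -> peval (ppow n P k) x = peval P x ^ k.
Proof.
  intros Hx HP. induction k as [|k IH]; simpl; [apply peval_pone|].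
  rewrite (peval_pmul n) by (auto using wf_ppow). now rewrite IH.
Qed.

Lemma monoval_from_pos a : forall i x,
  (forall j, (i <= j < i + length a)%nat -> 0 < x j) -> 0 < monoval_from i x a.
Proof.
  induction a as [|e a IH]; intros i x H; simpl in *; [lra|].
  apply Rmult_lt_0_compat; [apply pow_lt, H; lia|]. apply IH. intros; apply H; lia.
Qed.

Lemma monoval_pos n x a : inTpos n x -> length a = n -> 0 < monoval x a.
Proof. intros H E. apply monoval_from_pos. intros; apply H; lia. Qed.

Lemma termval_pos n x m : inTpos n x -> wfterm n m -> 0 < fst m -> 0 < termval x m.
Proof. intros Hx [_ E] H. apply Rmult_lt_0_compat; [exact H|]. now apply (monoval_pos n). Qed.

Lemma termval_pos_inv n x m : inTn n x -> wfterm n m -> 0 < termval x m -> 0 < fst m.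
Proof.
  intros Hx [H E] Hp. destruct H as [H|H]; [exact H|].
  unfold termval in Hp. rewrite <- H in Hp. lra.
Qed.

Lemma peval_pos n P x m : inTpos n x -> wf n P -> In m P -> 0 < fst m -> 0 < peval P x.
Proof.
  intros Hx HP Hm H. eapply Rlt_le_trans; [|apply peval_ub, Hm].
  apply (termval_pos n); eauto using wf_In.
Qed.

Lemma peval_le_of_coef_le n P Q x : inTn n x -> wf n P -> wf n Q ->
  (forall a, coef P a <= coef Q a) -> peval P x <= peval Q x.
Proof.
  intros Hx HP HQ H. apply peval_lub; [apply peval_nonneg|]. intros m Hm.
  assert (W := wf_In _ _ _ HP Hm). destruct W as [Hc HL].
  assert (H0 := monoval_nonneg n x (snd m) Hx HL).
  destruct Hc as [Hc|Hc].
  - assert (Hm' := coef_ub P m Hm). specialize (H (snd m)).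
    destruct (coef_attained Q (snd m)) as [m' [Hm1 [E1 E2]]]; [lra|].
    apply Rle_trans with (termval x m'); [|now apply peval_ub].
    unfold termval. rewrite E1, E2. apply Rmult_le_compat_r; lra.
  - unfold termval. rewrite <- Hc, Rmult_0_l. apply peval_nonneg.
Qed.

Lemma peval_peq n P Q x : inTn n x -> wf n P -> wf n Q -> peq P Q -> peval P x = peval Q x.
Proof.
  intros Hx HP HQ H. apply Rle_antisym; apply (peval_le_of_coef_le n); auto;
    intros a; rewrite (H a); lra.
Qed.

Lemma pnz_pos_term P : pnz P -> exists m, In m P /\ 0 < fst m.
Proof.
  intros [a H]. assert (N := coef_nonneg P a).
  destruct (coef_attained P a) as [m [Hm [_ E]]]; [lra|]. exists m. split; [exact Hm|lra].
Qed.

Lemma pos_term_pnz P m : In m P -> 0 < fst m -> pnz P.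
Proof. intros Hm H. exists (snd m). assert (h := coef_ub P m Hm). lra. Qed.

(** At a positive point the nonzero multiplier [U] has a positive value and cancels. At a point with
    a zero coordinate [U] may vanish, hence the restriction to [inTpos]. *)
Lemma tdivides_eval n P S : wf n P -> wf n S -> tdivides n P S ->
  exists R, wf n R /\ forall x, inTpos n x -> peval S x = peval P x * peval R x.
Proof.
  intros HP HS [R [HR [U [HU [NU E]]]]]. exists R. split; [exact HR|]. intros x Hx.
  assert (Hx' := inTpos_inTn n x Hx).
  apply (peval_peq n _ _ x Hx') in E; auto using wf_pmul.
  rewrite !(peval_pmul n) in E by auto using wf_pmul.
  destruct (pnz_pos_term U NU) as [m [Hm Hc]].
  assert (H := peval_pos n U x m Hx HU Hm Hc).
  apply (Rmult_eq_reg_l (peval U x)); lra.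
Qed.

(** * Extension from positive points to [T^n] *)

Lemma Rmax_continuity_pt f g a : continuity_pt f a -> continuity_pt g a ->
  continuity_pt (fun t => Rmax (f t) (g t)) a.
Proof.
  intros Hf Hg.
  apply (continuity_pt_locally_ext (fun t => (f t + g t + Rabs (f t - g t)) * / 2) _ 1 a Rlt_0_1).
  - intros t _. unfold Rmax, Rabs. destruct (Rle_dec (f t) (g t)), (Rcase_abs (f t - g t)); lra.
  - apply (continuity_pt_mult (fun t => f t + g t + Rabs (f t - g t)) (fun _ => / 2)).
    + apply (continuity_pt_plus (fun t => f t + g t) (fun t => Rabs (f t - g t))).
      * now apply (continuity_pt_plus f g).
      * apply (continuity_pt_comp (fun t => f t - g t) Rabs).
        -- now apply (continuity_pt_minus f g).
        -- apply Rcontinuity_abs.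
    + apply continuity_pt_const. now intros ? ?.
Qed.

Lemma peval_shift_continuity P x a : continuity_pt (fun t => peval P (fun i => x i + t)) a.
Proof.
  induction P as [|m P IH].
  - apply continuity_pt_const. now intros ? ?.
  - apply (Rmax_continuity_pt (fun t => termval (fun i => x i + t) m)); [|exact IH].
    apply (continuity_pt_mult (fun _ => fst m) (fun t => monoval (fun i => x i + t) (snd m))).
    + apply continuity_pt_const. now intros ? ?.
    + unfold monoval. generalize 0%nat. induction (snd m) as [|e b IHb]; intros i; simpl.
      * apply continuity_pt_const. now intros ? ?.
      * apply (continuity_pt_mult (fun t => (x i + t) ^ e)); [|apply IHb].
        apply (continuity_pt_comp (fun t => x i + t) (fun u => u ^ e)); [|reg].
        reg.
Qed.

Lemma continuity_pt_zero_right f a :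
  continuity_pt f a -> (forall t, a < t -> f t = 0) -> f a = 0.
Proof.
  intros Hf H. apply NNPP. intros Hn.
  destruct (Hf (Rabs (f a)) (Rabs_pos_lt _ Hn)) as [d [Hd Hlim]].
  specialize (Hlim (a + d / 2)). simpl in Hlim. unfold R_dist in Hlim.
  rewrite (H (a + d / 2)) in Hlim by lra.
  replace (0 - f a) with (- f a) in Hlim by ring. rewrite Rabs_Ropp in Hlim.
  apply (Rlt_irrefl (Rabs (f a))). apply Hlim. split.
  - split; [exact I|lra].
  - replace (a + d / 2 - a) with (d / 2) by ring. rewrite Rabs_pos_eq; lra.
Qed.

(** The diagonal translates of a point of [T^n] by [t > 0] are positive points, and both sides are
    continuous in [t] at [0]. *)
Lemma eval_identity_closure n P Q R k :
  (forall x, inTpos n x -> peval Q x ^ k = peval P x * peval R x) ->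
  forall x, inTn n x -> peval Q x ^ k = peval P x * peval R x.
Proof.
  intros H x Hx.
  set (f := fun t => peval Q (fun i => x i + t) ^ k
                     - peval P (fun i => x i + t) * peval R (fun i => x i + t)).
  assert (Hf : f 0 = 0).
  { apply continuity_pt_zero_right.
    - apply (continuity_pt_minus (fun t => peval Q (fun i => x i + t) ^ k)
              (fun t => peval P (fun i => x i + t) * peval R (fun i => x i + t))).
      + apply (continuity_pt_comp (fun t => peval Q (fun i => x i + t)) (fun u => u ^ k));
          [apply peval_shift_continuity|reg].
      + apply (continuity_pt_mult (fun t => peval P (fun i => x i + t)));
          apply peval_shift_continuity.
    - intros t Ht. unfold f. rewrite H; [lra|]. intros i Hi. specialize (Hx i Hi). lra. }
  unfold f in Hf.
  assert (E : forall A, peval A (fun i => x i + 0) = peval A x).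
  { intros A. unfold peval. f_equal. apply map_ext. intros m. unfold termval, monoval. f_equal.
    generalize 0%nat. induction (snd m) as [|e b IHb]; intros i; simpl; [reflexivity|].
    rewrite IHb. now rewrite Rplus_0_r. }
  rewrite !E in Hf. lra.
Qed.

(** * Translations along a logarithmic axis, and zeros of a product *)

Definition scale (s : nat) (t : R) (x : nat -> R) (i : nat) : R :=
  if Nat.eq_dec i s then t * x i else x i.

Lemma monoval_from_scale a : forall s t x i, (i <= s)%nat ->
  monoval_from i (scale s t x) a = t ^ nth (s - i) a 0%nat * monoval_from i x a.
Proof.
  assert (Hlt : forall a s t x i, (s < i)%nat ->
            monoval_from i (scale s t x) a = monoval_from i x a).
  { clear. induction a as [|e a IH]; intros s t x i H; simpl; [reflexivity|].
    rewrite IH by lia. unfold scale. destruct (Nat.eq_dec i s); [lia|reflexivity]. }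
  induction a as [|e a IH]; intros s t x i H; simpl.
  - destruct (s - i)%nat; simpl; lra.
  - unfold scale at 1. destruct (Nat.eq_dec i s) as [->|Hn].
    + rewrite Nat.sub_diag, Hlt by lia. simpl. rewrite Rpow_mult_distr. ring.
    + rewrite IH by lia. replace (s - i)%nat with (S (s - S i)) by lia. simpl. ring.
Qed.

Lemma termval_scale s t x m :
  termval (scale s t x) m = t ^ nth s (snd m) 0%nat * termval x m.
Proof.
  unfold termval, monoval. rewrite monoval_from_scale by lia. rewrite Nat.sub_0_r. ring.
Qed.

Lemma scale_inTn n s t x : 0 <= t -> inTn n x -> inTn n (scale s t x).
Proof.
  intros Ht Hx i Hi. unfold scale. destruct (Nat.eq_dec i s); [|auto].
  apply Rmult_le_pos; auto.
Qed.

Lemma scale_pos n s t x : 0 < t -> inTpos n x -> inTpos n (scale s t x).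
Proof.
  intros Ht Hx i Hi. unfold scale. destruct (Nat.eq_dec i s); [|auto].
  apply Rmult_lt_0_compat; auto.
Qed.

Lemma nth_ext_ne (a b : list nat) : length a = length b -> a <> b ->
  exists s, nth s a 0%nat <> nth s b 0%nat.
Proof.
  intros L H. apply NNPP. intros Hn. apply H. apply (nth_ext a b 0%nat 0%nat L).
  intros s _. apply NNPP. intros E. apply Hn. eauto.
Qed.

(** A strict gap survives finitely many factors close to 1: the induction hypothesis uses half of
    the gap and the last factor the other half. *)
Lemma pow_slack D : forall v q, 0 <= v -> v < q ->
  exists t0, 1 < t0 /\ forall t, 1 <= t <= t0 -> t ^ D * v <= q.
Proof.
  induction D as [|D IH]; intros v q Hv Hq.
  - exists 2. split; [lra|]. intros. simpl. lra.
  - destruct (IH v ((v + q) / 2)) as [t0 [Ht0 H]]; [lra|lra|].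
    assert (Hr : 1 < q / ((v + q) / 2)).
    { apply (Rmult_lt_reg_r ((v + q) / 2)); [lra|]. field_simplify; lra. }
    exists (Rmin t0 (q / ((v + q) / 2))). split; [now apply Rmin_glb_lt|].
    intros t [Ht1 Ht2]. generalize (Rmin_l t0 (q / ((v + q) / 2))).
    generalize (Rmin_r t0 (q / ((v + q) / 2))). intros Ha Hb.
    specialize (H t ltac:(lra)). simpl. rewrite Rmult_assoc.
    apply Rle_trans with (t * ((v + q) / 2)); [apply Rmult_le_compat_l; lra|].
    apply Rle_trans with (q / ((v + q) / 2) * ((v + q) / 2)).
    + apply Rmult_le_compat_r; lra.
    + right. field. lra.
Qed.

Lemma pow_ge_1 t k : 1 <= t -> 1 <= t ^ k.
Proof. intros. now apply pow_R1_Rle. Qed.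

(* Near a non-zero the dominant monomial stays dominant, so [log Q] is affine there. *)
Lemma nonzero_scale n Q x s : inTn n x -> wf n Q -> ~ is_zero Q x ->
  exists t, 1 < t /\
    peval Q (scale s t x) * peval Q (scale s (/ t) x) <= peval Q x * peval Q x.
Proof.
  intros Hx HQ Hz. assert (N := peval_nonneg Q x).
  assert (Hp : 0 < peval Q x).
  { destruct N as [N|N]; [exact N|]. exfalso. apply Hz. left. auto. }
  destruct (peval_attained Q x Hp) as [q [Hq Eq]].
  set (b := nth s (snd q) 0%nat).
  assert (Hu : forall m, In m Q -> snd m <> snd q -> termval x m < peval Q x).
  { intros m Hm Hne. destruct (peval_ub Q x m Hm) as [h|h]; [exact h|].
    exfalso. apply Hz. right. exists m, q. auto. }
  (* Induction over sublists, taking minima of the admissible [t], gives one range of [t] for all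
     terms. The exponent [b] of the dominant term is the slope in both directions. *)
  assert (Ht : forall Q', incl Q' Q -> exists t0, 1 < t0 /\ forall t, 1 <= t <= t0 ->
             forall m, In m Q' ->
               termval (scale s t x) m <= t ^ b * peval Q x /\
               termval (scale s (/ t) x) m <= / t ^ b * peval Q x).
  { induction Q' as [|m Q' IH]; intros Hincl.
    - exists 2. split; [lra|]. intros ? ? ? [].
    - destruct IH as [t0 [Ht0 IH]]; [intros ? ?; apply Hincl; now right|].
      assert (HmQ : In m Q) by (apply Hincl; now left).
      assert (Hm0 := termval_nonneg n x m Hx (wf_In _ _ _ HQ HmQ)).
      assert (Hm : exists t1, 1 < t1 /\ forall t, 1 <= t <= t1 ->
               termval (scale s t x) m <= t ^ b * peval Q x /\
               termval (scale s (/ t) x) m <= / t ^ b * peval Q x).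
      { destruct (list_eq_dec Nat.eq_dec (snd m) (snd q)) as [E|E].
        - exists 2. split; [lra|]. intros t Ht. rewrite !termval_scale, E. fold b.
          assert (h := peval_ub Q x m HmQ). assert (h1 := pow_ge_1 t b ltac:(lra)).
          rewrite pow_inv.
          assert (0 < / t ^ b) by (apply Rinv_0_lt_compat; lra).
          split; apply Rmult_le_compat_l; lra.
        - set (e := nth s (snd m) 0%nat).
          (* [ta] serves the move by [t]; [tb] serves the move by [/ t], where clearing the inverse
             powers brings [t ^ b] to the side of [m]. *)
          destruct (pow_slack e _ _ Hm0 (Hu m HmQ E)) as [ta [Hta Ha]].
          destruct (pow_slack b _ _ Hm0 (Hu m HmQ E)) as [tb [Htb Hb]].
          exists (Rmin ta tb). split; [now apply Rmin_glb_lt|].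
          intros t Ht. generalize (Rmin_l ta tb) (Rmin_r ta tb). intros h1 h2.
          specialize (Ha t ltac:(lra)). specialize (Hb t ltac:(lra)).
          rewrite !termval_scale. fold e. rewrite pow_inv.
          assert (h3 := pow_ge_1 t b ltac:(lra)). assert (h4 := pow_ge_1 t e ltac:(lra)).
          split; [nra|].
          apply (Rmult_le_reg_l (t ^ e * t ^ b)); [nra|].
          replace (t ^ e * t ^ b * (/ t ^ e * termval x m)) with (t ^ b * termval x m)
            by (field; lra).
          replace (t ^ e * t ^ b * (/ t ^ b * peval Q x)) with (t ^ e * peval Q x)
            by (field; lra).
          nra. }
      destruct Hm as [t1 [Ht1 Hm]].
      exists (Rmin t0 t1). split; [now apply Rmin_glb_lt|].
      intros t Ht. generalize (Rmin_l t0 t1) (Rmin_r t0 t1). intros h1 h2.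
      intros m' [<-|Hm']; [apply Hm; lra|apply IH; [lra|exact Hm']]. }
  destruct (Ht Q (incl_refl Q)) as [t [Ht1 H]]. specialize (H t ltac:(lra)).
  exists t. split; [exact Ht1|].
  assert (h3 := pow_ge_1 t b ltac:(lra)).
  assert (h4 : 0 < / t ^ b) by (apply Rinv_0_lt_compat; lra).
  replace (peval Q x * peval Q x) with ((t ^ b * peval Q x) * (/ t ^ b * peval Q x))
    by (field; lra).
  apply Rmult_le_compat; try apply peval_nonneg;
    (apply peval_lub; [apply Rmult_le_pos; lra|]); intros m Hm; now apply H.
Qed.

(** Quantitative convexity of log P along axis [s]: [m1] bounds P from below on one side of [x] and
    [m2] on the other. The difference of their exponents measures the kink; for [m1 = m2] this is
    midpoint convexity. *)
Lemma peval_scale_pair n P x s t m1 m2 : inTn n x -> wf n P -> 1 < t ->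
  In m1 P -> In m2 P -> termval x m1 = peval P x -> termval x m2 = peval P x ->
  (nth s (snd m2) 0 <= nth s (snd m1) 0)%nat ->
  t ^ (nth s (snd m1) 0 - nth s (snd m2) 0)%nat * (peval P x * peval P x) <=
  peval P (scale s t x) * peval P (scale s (/ t) x).
Proof.
  intros Hx HP Ht H1 H2 E1 E2 Hle.
  set (a := nth s (snd m1) 0%nat) in *. set (b := nth s (snd m2) 0%nat) in *.
  assert (A := peval_ub P (scale s t x) m1 H1). rewrite termval_scale, E1 in A. fold a in A.
  assert (B := peval_ub P (scale s (/ t) x) m2 H2). rewrite termval_scale, E2 in B. fold b in B.
  assert (N := peval_nonneg P x).
  assert (Pb : 1 <= t ^ b) by (apply pow_ge_1; lra).
  assert (Pa : 1 <= t ^ a) by (apply pow_ge_1; lra).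
  rewrite pow_inv in B.
  replace (t ^ (a - b) * (peval P x * peval P x))
    with ((t ^ a * peval P x) * (/ t ^ b * peval P x)).
  - assert (0 < / t ^ b) by (apply Rinv_0_lt_compat; lra).
    apply Rmult_le_compat; auto; apply Rmult_le_pos; lra.
  - replace (t ^ a) with (t ^ (a - b) * t ^ b).
    + field. lra.
    + rewrite <- pow_add. f_equal. lia.
Qed.

(** Suppose [x] is a zero of P but not of Q. Then P and R are positive at [x], log P has a kink
    along some axis and log R is convex, so the second difference of log Q^k is positive; near a
    non-zero of Q it is at most zero. *)
Lemma eval_factor_Vsub n P Q R k : wf n P -> wf n Q -> wf n R ->
  (forall x, inTpos n x -> peval Q x ^ k = peval P x * peval R x) -> Vsub n P Q.
Proof.
  intros HP HQ HR Hpos x Hx Hz. apply NNPP. intros Hn.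
  assert (H := eval_identity_closure n P Q R k Hpos). clear Hpos.
  assert (NQ := peval_nonneg Q x). assert (NP := peval_nonneg P x).
  assert (NR := peval_nonneg R x).
  assert (Qp : 0 < peval Q x).
  { destruct NQ as [h|h]; [exact h|]. exfalso. apply Hn. left. auto. }
  assert (Qk := pow_lt _ k Qp). assert (Ex := H x Hx).
  assert (Pp : 0 < peval P x).
  { destruct NP as [h|h]; [exact h|]. rewrite <- h in Ex. lra. }
  assert (Rp : 0 < peval R x).
  { destruct NR as [h|h]; [exact h|]. rewrite <- h in Ex. lra. }
  destruct Hz as [Hz|Hz]; [lra|].
  assert (Hw : exists m1 m2 s, In m1 P /\ In m2 P /\ termval x m1 = peval P x /\
            termval x m2 = peval P x /\ (nth s (snd m2) 0 < nth s (snd m1) 0)%nat).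
  { destruct Hz as [m1 [m2 [H1 [H2 [Hne [E1 E2]]]]]].
    (* Distinct exponents differ in some variable [s], which is the axis along which the kink is
       seen. *)
    destruct (nth_ext_ne (snd m1) (snd m2)) as [s Hs]; [|exact Hne|].
    - destruct (wf_In _ _ _ HP H1) as [_ L1], (wf_In _ _ _ HP H2) as [_ L2].
      exact (eq_trans L1 (eq_sym L2)).
    - destruct (Nat.lt_ge_cases (nth s (snd m2) 0%nat) (nth s (snd m1) 0%nat)) as [h|h].
      + exists m1, m2, s. auto.
      + exists m2, m1, s. repeat split; auto. lia. }
  destruct Hw as [m1 [m2 [s [H1 [H2 [E1 [E2 Hs]]]]]]].
  destruct (nonzero_scale n Q x s Hx HQ Hn) as [t [Ht HQt]].
  assert (It : 0 < / t) by (apply Rinv_0_lt_compat; lra).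
  assert (Hxt := scale_inTn n s t x ltac:(lra) Hx).
  assert (Hxi := scale_inTn n s (/ t) x ltac:(lra) Hx).
  assert (HPt := peval_scale_pair n P x s t m1 m2 Hx HP Ht H1 H2 E1 E2 ltac:(lia)).
  destruct (peval_attained R x Rp) as [r [Hr Er]].
  (* Using the same term twice makes the exponent difference zero, which leaves plain convexity of
     log R. *)
  assert (HRt := peval_scale_pair n R x s t r r Hx HR Ht Hr Hr Er Er ltac:(lia)).
  rewrite Nat.sub_diag in HRt. simpl in HRt. rewrite Rmult_1_l in HRt.
  assert (Hd : t <= t ^ (nth s (snd m1) 0 - nth s (snd m2) 0)%nat).
  { destruct (nth s (snd m1) 0 - nth s (snd m2) 0)%nat as [|d] eqn:E; [lia|]. simpl.
    assert (h := pow_ge_1 t d ltac:(lra)). nra. }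
  assert (HQk : (peval Q (scale s t x) * peval Q (scale s (/ t) x)) ^ k
                <= (peval Q x * peval Q x) ^ k).
  { apply pow_incr. split; [|exact HQt]. apply Rmult_le_pos; apply peval_nonneg. }
  rewrite !Rpow_mult_distr, !H in HQk by auto.
  set (p := peval P x) in *. set (r0 := peval R x) in *.
  set (pp := peval P (scale s t x) * peval P (scale s (/ t) x)) in *.
  set (rr := peval R (scale s t x) * peval R (scale s (/ t) x)) in *.
  assert (Hpp : t * (p * p) <= pp).
  { eapply Rle_trans; [|exact HPt]. apply Rmult_le_compat_r; nra. }
  assert (K : pp * rr <= (p * p) * (r0 * r0)) by (unfold pp, rr; lra).
  assert (p2 : 0 < p * p) by nra. assert (r2 : 0 < r0 * r0) by nra.
  assert ((t * (p * p)) * (r0 * r0) <= pp * rr) by (apply Rmult_le_compat; nra).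
  assert (p * p * (r0 * r0) > 0) by nra. nra.
Qed.

(** * Cancellation: equality of functions is equality in [T{X_1..X_n}] *)

(** Terms with coefficient zero have no logarithm; dropping them does not change the function. *)
Definition positive_part (P : tpoly) : tpoly :=
  filter (fun f => if Rlt_dec 0 (fst f) then true else false) P.

Lemma In_positive_part P f : In f (positive_part P) <-> In f P /\ 0 < fst f.
Proof.
  unfold positive_part. rewrite filter_In. destruct (Rlt_dec 0 (fst f)); intuition congruence.
Qed.

Lemma ln_le x y : 0 < x -> x <= y -> ln x <= ln y.
Proof. intros Hx [H| ->]; [left; now apply ln_increasing|apply Rle_refl]. Qed.

(** The slope of the affine function that the term becomes in logarithmic coordinates, taken in [Z]
    because slopes get subtracted. *)
Definition lexp (m : R * expo) (i : nat) : Z := Z.of_nat (nth i (snd m) 0%nat).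

Lemma monoval_from_exp a : forall i x,
  (forall j, (i <= j < i + length a)%nat -> 0 < x j) ->
  monoval_from i x a =
  exp (dot (length a) (fun j => Z.of_nat (nth j a 0%nat)) (fun j => ln (x (i + j)%nat))).
Proof.
  induction a as [|e a IH]; intros i x H; simpl in *; [now rewrite exp_0|].
  rewrite exp_plus, IH by (intros; apply H; lia). f_equal.
  - rewrite Nat.add_0_r, <- INR_IZR_INZ. rewrite <- Rpower_pow by (apply H; lia). reflexivity.
  - f_equal. apply dot_ext; [reflexivity|]. intros j _. do 2 f_equal. lia.
Qed.

Lemma ln_termval n x m : inTpos n x -> wfterm n m -> 0 < fst m ->
  ln (termval x m) = ln (fst m) + dot n (lexp m) (fun i => ln (x i)).
Proof.
  intros Hx [_ E] H. unfold termval, monoval.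
  rewrite ln_mult; [|exact H|apply (monoval_pos n); auto].
  rewrite monoval_from_exp by (intros; apply Hx; lia).
  rewrite ln_exp, E. reflexivity.
Qed.

(** * Products of terms and powers of polynomials *)

Lemma addexp_comm a : forall b, addexp a b = addexp b a.
Proof. induction a as [|e a IH]; intros [|f b]; simpl; auto. rewrite IH. f_equal. lia. Qed.

Lemma addexp_assoc a : forall b c, addexp a (addexp b c) = addexp (addexp a b) c.
Proof.
  induction a as [|e a IH]; intros [|f b] [|g c]; simpl; auto. rewrite IH. f_equal. lia.
Qed.

Lemma nth_addexp a : forall b i, length a = length b ->
  nth i (addexp a b) 0%nat = (nth i a 0 + nth i b 0)%nat.
Proof.
  induction a as [|e a IH]; intros [|f b] [|i]; simpl; try lia; intros H; auto.
Qed.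

Lemma tmul_comm a b : tmul a b = tmul b a.
Proof. unfold tmul. f_equal; [ring|apply addexp_comm]. Qed.

Lemma tmul_assoc a b c : tmul a (tmul b c) = tmul (tmul a b) c.
Proof. unfold tmul. simpl. f_equal; [ring|apply addexp_assoc]. Qed.

Lemma lexp_tmul n a b i : wfterm n a -> wfterm n b ->
  lexp (tmul a b) i = (lexp a i + lexp b i)%Z.
Proof.
  intros [_ Ha] [_ Hb]. unfold lexp, tmul. simpl.
  rewrite nth_addexp by exact (eq_trans Ha (eq_sym Hb)). lia.
Qed.

Definition tprod (n : nat) (L : list (R * expo)) : R * expo :=
  fold_right tmul (1, repeat 0%nat n) L.

Lemma tprod_perm n L M : Permutation L M -> tprod n L = tprod n M.
Proof.
  induction 1; simpl; auto; try congruence.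
  rewrite !tmul_assoc. f_equal. apply tmul_comm.
Qed.

Lemma tprod_wf n L : wf n L -> wfterm n (tprod n L).
Proof.
  induction 1 as [|m L Hm HL IH]; simpl.
  - split; simpl; [lra|apply repeat_length].
  - now apply tmul_wf.
Qed.

Lemma tprod_pos n L : (forall m, In m L -> 0 < fst m) -> 0 < fst (tprod n L).
Proof.
  induction L as [|m L IH]; simpl; intros H; [lra|].
  apply Rmult_lt_0_compat; [apply H; auto|apply IH; auto].
Qed.

(** Powers are expanded without collecting equal exponents, so every product of [k] terms is
    literally listed and factors can be exchanged inside it. *)
Lemma In_ppow n P k m :
  In m (ppow n P k) <-> exists L, length L = k /\ incl L P /\ m = tprod n L.
Proof.
  revert m. induction k as [|k IH]; intros m; simpl.
  - split.
    + intros [<-|[]]. exists []. repeat split; auto. intros ? [].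
    + intros [[|a L] [E [_ ->]]]; [now left|discriminate].
  - rewrite In_pmul. split.
    + intros [m1 [m2 [H1 [H2 ->]]]]. apply IH in H2. destruct H2 as [L [E [HL ->]]].
      exists (m1 :: L). simpl. repeat split; auto.
      intros a [<-|Ha]; auto.
    + intros [[|m1 L] [E [HL ->]]]; [discriminate|].
      exists m1, (tprod n L). repeat split.
      * apply HL. now left.
      * apply IH. exists L. repeat split; [now injection E|]. intros a Ha. apply HL. now right.
Qed.

(* A term below the function F has its point (exponent, log coefficient) below the
   upper hull of the points of F, with rational barycentric coordinates since all
   exponents are integral. *)
Lemma dominated_power n F m : wf n F -> wfterm n m -> 0 < fst m ->
  (forall x, inTpos n x -> termval x m <= peval F x) ->
  exists L, L <> [] /\ incl L F /\
    snd (tprod n L) = snd (tprod n (repeat m (length L))) /\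
    fst (tprod n (repeat m (length L))) <= fst (tprod n L).
Proof.
  intros HF Hm Hc Hle.
  set (F' := positive_part F).
  assert (HF' := In_positive_part F). fold F' in HF'.
  (* A row compares a term of F with [m] in logarithmic coordinates. A solution would be a point
     where [m] exceeds F; the alternative is a list of terms whose exponents average to that of [m],
     with mean log coefficient at least as large. *)
  destruct (gordan n (R * expo) (fun f i => (lexp f i - lexp m i)%Z)
              (fun f => ln (fst f) - ln (fst m)) F') as [[y Hy]|[L [Hnil [Hincl [HZ Hl]]]]].
  - exfalso.
    assert (Hx : inTpos n (fun i => exp (y i))) by (intros i _; apply exp_pos).
    set (x := fun i => exp (y i)) in *.
    assert (Hmx := termval_pos n x m Hx Hm Hc). specialize (Hle x Hx).
    destruct (peval_attained F x) as [f [Hf Ef]]; [lra|].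
    assert (Wf := wf_In _ _ _ HF Hf).
    assert (Hfc : 0 < fst f).
    { apply (termval_pos_inv n x); auto using inTpos_inTn. lra. }
    specialize (Hy f (proj2 (HF' f) (conj Hf Hfc))). rewrite dot_minus in Hy.
    assert (E1 := ln_termval n x f Hx Wf Hfc). assert (E2 := ln_termval n x m Hx Hm Hc).
    assert (Ed : forall v, dot n v (fun i => ln (x i)) = dot n v y).
    { intros v. apply dot_ext; [reflexivity|]. intros i _. unfold x. apply ln_exp. }
    rewrite Ed in E1, E2.
    assert (h : ln (termval x m) <= ln (termval x f)) by (apply ln_le; lra).
    lra.
  - exists L.
    assert (HL : wf n L).
    { eapply incl_Forall; [|exact HF]. intros f Hf. apply HF', Hincl, Hf. }
    assert (HLp : forall f, In f L -> 0 < fst f) by (intros f Hf; apply HF', Hincl, Hf).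
    assert (Hrp : forall k, 0 < fst (tprod n (repeat m k))).
    { intros k. apply tprod_pos. intros a Ha. apply repeat_spec in Ha. now subst. }
    assert (Hrw : forall k, wfterm n (tprod n (repeat m k))).
    { intros k. apply tprod_wf, Forall_forall. intros a Ha. apply repeat_spec in Ha. now subst. }
    repeat split.
    + exact Hnil.
    + intros f Hf. apply HF', Hincl, Hf.
    + assert (E : forall i, sumZ (fun f i => (lexp f i - lexp m i)%Z) L i
                  = (lexp (tprod n L) i - lexp (tprod n (repeat m (length L))) i)%Z).
      { intros i. clear - HL Hm Hrw. induction HL as [|f L Hf HL IH]; simpl; [lia|].
        rewrite IH, !(lexp_tmul n); auto using tprod_wf. lia. }
      destruct (tprod_wf n L HL) as [_ L1]. destruct (Hrw (length L)) as [_ L2].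
      apply (nth_ext _ _ 0%nat 0%nat); [exact (eq_trans L1 (eq_sym L2))|].
      intros i Hi. specialize (HZ i ltac:(rewrite <- L1; exact Hi)).
      rewrite E in HZ. unfold lexp in HZ. lia.
    + assert (E : sumR (fun f => ln (fst f) - ln (fst m)) L
                  = ln (fst (tprod n L)) - ln (fst (tprod n (repeat m (length L))))).
      { clear - HLp Hc Hrp. induction L as [|f L IH]; simpl; [lra|].
        rewrite IH by (intros; apply HLp; now right).
        rewrite !ln_mult; auto.
        - lra.
        - apply HLp; now left.
        - apply tprod_pos. intros; apply HLp; now right. }
      rewrite E in Hl. apply Rnot_lt_le. intros h.
      apply ln_increasing in h; [lra|]. now apply tprod_pos.
Qed.

(** A termwise certificate for the inequality of coefficients, which passes to products without
    computing the maxima in [coef]. *)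
Definition dominates (Q P : tpoly) : Prop :=
  forall m, In m P -> 0 < fst m -> exists m', In m' Q /\ snd m' = snd m /\ fst m <= fst m'.

Lemma dominates_coef P Q a : dominates Q P -> coef P a <= coef Q a.
Proof.
  intros H. destruct (coef_nonneg P a) as [Hp|Hp].
  - destruct (coef_attained P a Hp) as [m [Hm [E1 E2]]].
    destruct (H m Hm ltac:(lra)) as [m' [Hm' [E3 E4]]].
    assert (h := coef_ub Q m' Hm'). rewrite E3, E1 in h. lra.
  - rewrite <- Hp. apply coef_nonneg.
Qed.

Lemma dominates_incl P P' Q Q' :
  incl P P' -> incl Q' Q -> dominates Q' P' -> dominates Q P.
Proof.
  intros HP HQ H m Hm Hc. destruct (H m (HP m Hm) Hc) as [m' [Hm' E]].
  exists m'. split; auto.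
Qed.

Lemma dominates_pmul n U P Q :
  wf n U -> wf n P -> dominates Q P -> dominates (pmul U Q) (pmul U P).
Proof.
  intros HU HP H t Ht Hc. apply In_pmul in Ht. destruct Ht as [u [p [Hu [Hp ->]]]].
  destruct (wf_In _ _ _ HU Hu) as [Nu _], (wf_In _ _ _ HP Hp) as [Np _].
  simpl in Hc.
  destruct Np as [Np|Np]; [|rewrite <- Np in Hc; lra].
  destruct (H p Hp Np) as [q [Hq [E1 E2]]].
  exists (tmul u q). split; [apply In_pmul; eauto|]. simpl. rewrite E1. split; [reflexivity|].
  apply Rmult_le_compat_l; auto.
Qed.

Lemma pmul_assoc_incl P Q S :
  incl (pmul P (pmul Q S)) (pmul (pmul P Q) S) /\ incl (pmul (pmul P Q) S) (pmul P (pmul Q S)).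
Proof.
  split; intros m Hm; apply In_pmul in Hm; destruct Hm as [a [b [Ha [Hb ->]]]].
  - apply In_pmul in Hb. destruct Hb as [c [d [Hc [Hd ->]]]].
    rewrite tmul_assoc. apply In_pmul. exists (tmul a c), d. repeat split; auto.
    apply In_pmul. eauto.
  - apply In_pmul in Ha. destruct Ha as [c [d [Hc [Hd ->]]]].
    rewrite <- tmul_assoc. apply In_pmul. exists c, (tmul d b). repeat split; auto.
    apply In_pmul. eauto.
Qed.

Lemma pmul_comm_incl P Q S : incl (pmul (pmul P Q) S) (pmul (pmul Q P) S).
Proof.
  intros m Hm. apply In_pmul in Hm. destruct Hm as [a [b [Ha [Hb ->]]]].
  apply In_pmul in Ha. destruct Ha as [c [d [Hc [Hd ->]]]].
  apply In_pmul. exists (tmul c d), b. repeat split; auto.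
  apply In_pmul. exists d, c. repeat split; auto. apply tmul_comm.
Qed.

Lemma dominates_pmul_l n V U P Q : wf n V -> wf n U -> wf n P ->
  dominates (pmul U Q) (pmul U P) -> dominates (pmul (pmul V U) Q) (pmul (pmul V U) P).
Proof.
  intros HV HU HP H.
  apply (dominates_incl _ (pmul V (pmul U P)) _ (pmul V (pmul U Q)));
    try apply pmul_assoc_incl.
  apply (dominates_pmul n); auto using wf_pmul.
Qed.

Lemma dominates_pmul_r n V U P Q : wf n V -> wf n U -> wf n P ->
  dominates (pmul U Q) (pmul U P) -> dominates (pmul (pmul U V) Q) (pmul (pmul U V) P).
Proof.
  intros HV HU HP H.
  apply (dominates_incl _ (pmul (pmul V U) P) _ (pmul (pmul V U) Q));
    try apply pmul_comm_incl.
  now apply (dominates_pmul_l n).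
Qed.

(* With [m^N <= F^N], multiplication by [U = (m + F)^(N-1)] absorbs [m] into [F]. *)
Lemma absorb_term n F m : wf n F -> wfterm n m ->
  (forall x, inTpos n x -> termval x m <= peval F x) ->
  exists U, wf n U /\ pnz U /\ dominates (pmul U F) (pmul U [m]).
Proof.
  intros HF Hm Hle. destruct (Hm) as [[Hc|Hc] _].
  - destruct (dominated_power n F m HF Hm Hc Hle) as [L [Hnil [HL [E1 E2]]]].
    destruct L as [|f L]; [congruence|]. clear Hnil. simpl length in *.
    assert (HmF : wf n (m :: F)) by now constructor.
    exists (ppow n (m :: F) (length L)). repeat split.
    + now apply wf_ppow.
    + apply (pos_term_pnz _ (tprod n (repeat m (length L)))).
      * apply In_ppow. exists (repeat m (length L)). repeat split; [apply repeat_length|].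
        intros a Ha. apply repeat_spec in Ha. subst. now left.
      * apply tprod_pos. intros a Ha. apply repeat_spec in Ha. now subst.
    + intros t Ht _. apply In_pmul in Ht. destruct Ht as [u [m0 [Hu [[<-|[]] ->]]]].
      apply In_ppow in Hu. destruct Hu as [M [EM [HM ->]]].
      destruct (classic (exists g, In g M /\ In g F)) as [[g [Hg HgF]]|Hno].
      (* Some factor [g] of the product comes from F. Exchanging it with the external [m] leaves the
         product unchanged and exhibits it as a term of U F. *)
      * apply in_split in Hg. destruct Hg as [M1 [M2 ->]].
        exists (tmul (tprod n (M1 ++ m :: M2)) g).
        assert (E : tmul (tprod n (M1 ++ m :: M2)) g = tmul (tprod n (M1 ++ g :: M2)) m).
        { rewrite (tmul_comm _ g), (tmul_comm _ m).
          change (tprod n (g :: M1 ++ m :: M2) = tprod n (m :: M1 ++ g :: M2)).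
          apply tprod_perm.
          apply Permutation_trans with (g :: m :: M1 ++ M2).
          - apply perm_skip, Permutation_sym, Permutation_middle.
          - apply Permutation_trans with (m :: g :: M1 ++ M2); [apply perm_swap|].
            apply perm_skip, Permutation_middle. }
        rewrite E. split; [|split; [reflexivity|apply Rle_refl]]. rewrite <- E.
        apply In_pmul. exists (tprod n (M1 ++ m :: M2)), g. repeat split; auto.
        apply In_ppow. exists (M1 ++ m :: M2). repeat split.
        -- rewrite <- EM, !length_app. reflexivity.
        -- intros a Ha. apply in_app_iff in Ha. destruct Ha as [Ha|[<-|Ha]].
           ++ apply HM, in_app_iff. now left.
           ++ now left.
           ++ apply HM, in_app_iff. right. now right.
      (* Otherwise all factors are [m], and together with the external one they form m^N. It is
         dominated by the product of the N terms [f :: L], read as a term of U F with [f] as the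
         external factor. *)
      * assert (EMr : M = repeat m (length L)).
        { rewrite <- EM. apply Forall_eq_repeat, Forall_forall. intros a Ha.
          destruct (HM a Ha) as [h|h]; [exact h|]. exfalso. apply Hno. eauto. }
        subst M. exists (tmul (tprod n L) f). repeat split.
        -- apply In_pmul. exists (tprod n L), f. repeat split; [|apply HL; now left].
           apply In_ppow. exists L. repeat split. intros a Ha. right. apply HL. now right.
        -- rewrite (tmul_comm _ f), (tmul_comm _ m). exact E1.
        -- rewrite (tmul_comm _ f), (tmul_comm _ m). exact E2.
  - exists (pone n). repeat split.
    + apply wf_pone.
    + apply (pos_term_pnz _ (1, repeat 0%nat n)); [now left|simpl; lra].
    + intros t Ht Hp. apply In_pmul in Ht. destruct Ht as [u [m0 [Hu [[<-|[]] ->]]]].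
      simpl in Hp. rewrite <- Hc in Hp. lra.
Qed.

Lemma pnz_pmul U V : pnz U -> pnz V -> pnz (pmul U V).
Proof.
  intros HU HV. destruct (pnz_pos_term U HU) as [u [Hu Pu]].
  destruct (pnz_pos_term V HV) as [v [Hv Pv]].
  apply (pos_term_pnz _ (tmul u v)); [apply In_pmul; eauto|].
  simpl. now apply Rmult_lt_0_compat.
Qed.

(** The multipliers that absorb the single terms of G are multiplied together; domination survives
    the extra factors. *)
Lemma absorb_poly n F G : wf n F -> wf n G ->
  (forall x, inTpos n x -> peval G x <= peval F x) ->
  exists U, wf n U /\ pnz U /\ dominates (pmul U F) (pmul U G).
Proof.
  intros HF. induction 1 as [|m G Hm HG IH]; intros Hle.
  - exists (pone n). repeat split.
    + apply wf_pone.
    + apply (pos_term_pnz _ (1, repeat 0%nat n)); [now left|simpl; lra].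
    + intros t [].
  - destruct IH as [U2 [W2 [Z2 D2]]].
    { intros x Hx. eapply Rle_trans; [|apply Hle, Hx]. apply peval_incl. intros a; now right. }
    destruct (absorb_term n F m HF Hm) as [U1 [W1 [Z1 D1]]].
    { intros x Hx. eapply Rle_trans; [|apply Hle, Hx]. apply peval_ub. now left. }
    exists (pmul U1 U2). repeat split; auto using wf_pmul, pnz_pmul.
    assert (Wm : wf n [m]) by (constructor; [exact Hm|constructor]).
    assert (D1' := dominates_pmul_r n U2 U1 [m] F W2 W1 Wm D1).
    assert (D2' := dominates_pmul_l n U1 U2 G F W1 W2 HG D2).
    intros t Ht Hp. apply In_pmul in Ht. destruct Ht as [u [g [Hu [[<-|Hg] ->]]]].
    + apply D1'; [|exact Hp]. apply In_pmul. exists u, m. simpl. auto.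
    + apply D2'; [|exact Hp]. apply In_pmul. eauto.
Qed.

(** F absorbs G after multiplication by [U], and G absorbs F after multiplication by [V]. The common
    multiplier [pmul U V] keeps both inequalities, and antisymmetry gives equal coefficients. *)
Theorem eval_eq_cancel n F G : wf n F -> wf n G ->
  (forall x, inTpos n x -> peval F x = peval G x) ->
  exists U, wf n U /\ pnz U /\ peq (pmul U F) (pmul U G).
Proof.
  intros HF HG E.
  destruct (absorb_poly n F G HF HG) as [U [WU [ZU DU]]].
  { intros x Hx. rewrite E by auto. lra. }
  destruct (absorb_poly n G F HG HF) as [V [WV [ZV DV]]].
  { intros x Hx. rewrite E by auto. lra. }
  exists (pmul U V). repeat split; auto using wf_pmul, pnz_pmul.
  intros a. apply Rle_antisym; apply dominates_coef.
  - now apply (dominates_pmul_l n).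
  - now apply (dominates_pmul_r n).
Qed.

(** * Cells of a tropical polynomial *)

(** The straight segment from [z] to [w] in logarithmic coordinates; logarithms of terms are affine
    in [t] along it. *)
Definition seg (t : R) (z w : nat -> R) (i : nat) : R :=
  exp ((1 - t) * ln (z i) + t * ln (w i)).

Lemma seg_pos n t z w : inTpos n (seg t z w).
Proof. intros i _. apply exp_pos. Qed.

Lemma ln_termval_seg n t z w m : inTpos n z -> inTpos n w -> wfterm n m -> 0 < fst m ->
  ln (termval (seg t z w) m) = (1 - t) * ln (termval z m) + t * ln (termval w m).
Proof.
  intros Hz Hw Hm Hc. rewrite !(ln_termval n); auto using seg_pos.
  rewrite (dot_ext n _ (lexp m) _ (fun i => (1 - t) * ln (z i) + t * ln (w i)));
    [|reflexivity|intros i _; apply ln_exp].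
  rewrite dot_comb. ring.
Qed.

(** Among the affine functions that become negative at [t = 1], one with the earliest root is the
    witness. Recording [g a < 0] ensures that it does not merely touch zero. *)
Lemma first_crossing {A} (f g : A -> R) (L : list A) :
  (forall a, In a L -> 0 <= f a) -> (exists a, In a L /\ g a < 0) ->
  exists t, 0 <= t <= 1 /\ (forall a, In a L -> 0 <= (1 - t) * f a + t * g a) /\
    exists a, In a L /\ g a < 0 /\ (1 - t) * f a + t * g a = 0.
Proof.
  assert (Hroot : forall a, 0 <= f a -> g a < 0 ->
    exists u, 0 <= u <= 1 /\ (1 - u) * f a + u * g a = 0).
  { intros a Ha Hg. exists (f a / (f a - g a)).
    assert (Hd : 0 < f a - g a) by lra.
    repeat split.
    - apply Rmult_le_pos; [lra|]. left. now apply Rinv_0_lt_compat.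
    - apply (Rmult_le_reg_r (f a - g a)); [lra|]. field_simplify; lra.
    - field. lra. }
  induction L as [|a L IH]; intros Hf Hg; [destruct Hg as [? [[] _]]|].
  assert (Hfa : 0 <= f a) by (apply Hf; now left).
  assert (HfL : forall b, In b L -> 0 <= f b) by (intros; apply Hf; now right).
  destruct (classic (exists b, In b L /\ g b < 0)) as [HL|HL].
  - destruct (IH HfL HL) as [t [Ht [H1 [b [Hb [Hgb Eb]]]]]].
    destruct (Rle_lt_dec 0 ((1 - t) * f a + t * g a)) as [h|h].
    + exists t. split; [exact Ht|]. split.
      * intros c [<-|Hc]; auto.
      * exists b. simpl. auto.
    (* The new function is already negative at [t], so its root [u] comes no later and replaces
       [t]. *)
    + assert (Hga : g a < 0) by nra.
      destruct (Hroot a Hfa Hga) as [u [Hu Eu]].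
      assert (Hut : u <= t) by nra.
      exists u. split; [exact Hu|]. split.
      * intros c [<-|Hc]; [lra|]. specialize (H1 c Hc). specialize (HfL c Hc).
        destruct (Rle_lt_dec (f c) (g c)); nra.
      * exists a. simpl. auto.
  - assert (HgL : forall b, In b L -> 0 <= g b).
    { intros b Hb. destruct (Rle_lt_dec 0 (g b)); [auto|]. exfalso. apply HL. eauto. }
    assert (Hga : g a < 0).
    { destruct Hg as [b [[<-|Hb] h]]; [exact h|]. specialize (HgL b Hb). lra. }
    destruct (Hroot a Hfa Hga) as [u [Hu Eu]].
    exists u. split; [exact Hu|]. split.
    + intros c [<-|Hc]; [lra|]. specialize (HgL c Hc). specialize (HfL c Hc). nra.
    + exists a. simpl. auto.
Qed.

(** The competitors of [q] are given by position in the list, so a second copy of [q] counts as one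
    and empties the cell. *)
Definition in_cell (A B : tpoly) (q : R * expo) (x : nat -> R) : Prop :=
  peval (A ++ B) x < termval x q.

Lemma in_cell_peval A B q x : in_cell A B q x -> peval (A ++ q :: B) x = termval x q.
Proof.
  intros H. assert (N := peval_nonneg (A ++ B) x). unfold in_cell in H. apply Rle_antisym.
  - apply peval_lub; [lra|]. intros m Hm. apply in_app_iff in Hm.
    destruct Hm as [Hm|[<-|Hm]]; [|apply Rle_refl|];
      (apply Rle_trans with (peval (A ++ B) x); [apply peval_ub, in_app_iff; auto|lra]).
  - apply peval_ub, in_app_iff. right. now left.
Qed.

Lemma in_cell_nonzero A B q x : in_cell A B q x -> ~ is_zero (A ++ q :: B) x.
Proof.
  intros H. assert (N := peval_nonneg (A ++ B) x).
  assert (E := in_cell_peval A B q x H). unfold in_cell in H.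
  assert (Hu : forall m, In m (A ++ q :: B) -> termval x m = peval (A ++ q :: B) x -> m = q).
  { intros m Hm Em. apply in_app_iff in Hm. destruct Hm as [Hm|[<-|Hm]]; [|reflexivity|];
      (assert (h : termval x m <= peval (A ++ B) x) by (apply peval_ub, in_app_iff; auto); lra). }
  intros [Hz|[m1 [m2 [H1 [H2 [Hne [E1 E2]]]]]]]; [lra|].
  apply Hne. now rewrite (Hu m1), (Hu m2).
Qed.

Lemma in_cell_intro n A B q x : inTpos n x -> wf n (A ++ q :: B) -> 0 < fst q ->
  (forall m, In m (A ++ B) -> 0 < fst m -> ln (termval x m) < ln (termval x q)) ->
  in_cell A B q x.
Proof.
  intros Hx HQ Hq H.
  assert (Wq : wfterm n q) by (apply (wf_In n (A ++ q :: B)); [auto|apply in_elt]).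
  assert (Pq := termval_pos n x q Hx Wq Hq).
  unfold in_cell. destruct (peval_nonneg (A ++ B) x) as [Hp|Hp]; [|lra].
  destruct (peval_attained _ _ Hp) as [m [Hm Em]]. rewrite <- Em.
  assert (Wm : wfterm n m).
  { apply (wf_In n (A ++ q :: B)); [auto|]. apply in_app_iff in Hm. apply in_app_iff.
    simpl. tauto. }
  apply ln_lt_inv; [lra|exact Pq|]. apply H; [exact Hm|].
  apply (termval_pos_inv n x); auto using inTpos_inTn. lra.
Qed.

(** * One cell of Q, with dominant term [q], and the term [p] of P maximal at a point of it *)

Section Cell.

Variables (n : nat) (P A B : tpoly) (q : R * expo) (z : nat -> R) (p : R * expo).
Hypotheses (HP : wf n P) (HQ : wf n (A ++ q :: B)) (HV : Vsub n P (A ++ q :: B)).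
Hypotheses (Hz : inTpos n z) (Hcz : in_cell A B q z).
Hypotheses (Hp : In p P) (Ep : termval z p = peval P z).

Let Q := A ++ q :: B.

Lemma cell_wf_q : wfterm n q.
Proof. apply (wf_In n Q); [auto|apply in_elt]. Qed.

Lemma cell_wf_other m : In m (A ++ B) -> wfterm n m.
Proof.
  intros Hm. apply (wf_In n Q); [auto|]. apply in_app_iff in Hm. apply in_app_iff.
  simpl. tauto.
Qed.

Lemma cell_pos_q : 0 < fst q.
Proof.
  apply (termval_pos_inv n z); auto using inTpos_inTn, cell_wf_q.
  unfold in_cell in Hcz. assert (N := peval_nonneg (A ++ B) z). lra.
Qed.

Lemma cell_P_pos x : inTn n x -> in_cell A B q x -> 0 < peval P x.
Proof.
  intros Hx Hc. destruct (peval_nonneg P x) as [h|h]; [exact h|]. exfalso.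
  apply (in_cell_nonzero A B q x Hc). apply HV; [exact Hx|]. left. auto.
Qed.

Lemma cell_pos_p : 0 < fst p.
Proof.
  apply (termval_pos_inv n z); auto using inTpos_inTn.
  - now apply (wf_In n P).
  - rewrite Ep. apply cell_P_pos; auto using inTpos_inTn.
Qed.

(* Cells are log-convex; along a segment of the cell, the first term of P to catch up
   with p would produce a zero of P that is not a zero of Q. *)
Lemma cell_top_term w l : inTpos n w -> in_cell A B q w -> In l P ->
  termval w l <= termval w p.
Proof.
  intros Hw Hcw Hl. apply Rnot_lt_le. intros Hlt.
  assert (Pp := cell_pos_p). assert (Wp := wf_In _ _ _ HP Hp).
  assert (Tpw := termval_pos n w p Hw Wp Pp). assert (Tpz := termval_pos n z p Hz Wp Pp).
  set (P' := positive_part P).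
  assert (HP' := In_positive_part P). fold P' in HP'.
  destruct (first_crossing (fun m => ln (termval z p) - ln (termval z m))
              (fun m => ln (termval w p) - ln (termval w m)) P')
    as [t [Ht [Hall [m [Hm [Hgm Em]]]]]].
  - intros m Hm. apply HP' in Hm. destruct Hm as [Hm Hc].
    assert (h := termval_pos n z m Hz (wf_In _ _ _ HP Hm) Hc).
    assert (h' : ln (termval z m) <= ln (termval z p)).
    { apply ln_le; [exact h|]. rewrite Ep. now apply peval_ub. }
    lra.
  - exists l. split.
    + apply HP'. split; [exact Hl|].
      apply (termval_pos_inv n w); auto using inTpos_inTn.
      * now apply (wf_In n P).
      * lra.
    + apply ln_increasing in Hlt; [lra|exact Tpw].
  - apply HP' in Hm. destruct Hm as [Hm Hmc]. assert (Wm := wf_In _ _ _ HP Hm).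
    set (x := seg t z w).
    assert (Hx : inTpos n x) by apply seg_pos.
    assert (Tpx := termval_pos n x p Hx Wp Pp).
    assert (Tmx := termval_pos n x m Hx Wm Hmc).
    assert (Hcx : in_cell A B q x).
    { apply (in_cell_intro n); auto using cell_pos_q. intros m' Hm' Hc'.
      assert (W' := cell_wf_other m' Hm').
      unfold x. rewrite !(ln_termval_seg n); auto using cell_wf_q, cell_pos_q.
      assert (h1 : ln (termval z m') < ln (termval z q)).
      { apply ln_increasing; [now apply (termval_pos n)|].
        eapply Rle_lt_trans; [apply peval_ub, Hm'|exact Hcz]. }
      assert (h2 : ln (termval w m') < ln (termval w q)).
      { apply ln_increasing; [now apply (termval_pos n)|].
        eapply Rle_lt_trans; [apply peval_ub, Hm'|exact Hcw]. }
      (* One of the weights [1 - t] and [t] is at least one half, so the combination of two strict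
         inequalities stays strict. *)
      destruct (Rle_lt_dec t (1 / 2)); nra. }
    assert (Etop : termval x p = peval P x).
    { apply Rle_antisym; [now apply peval_ub|]. apply peval_lub; [lra|].
      intros m' Hm'. destruct (wf_In _ _ _ HP Hm') as [[Hc'|Hc'] L'].
      - assert (W' := wf_In _ _ _ HP Hm').
        assert (h := Hall m' (proj2 (HP' m') (conj Hm' Hc'))). simpl in h.
        assert (T' := termval_pos n x m' Hx W' Hc').
        apply Rnot_lt_le. intros hlt. apply ln_increasing in hlt; [|exact Tpx].
        unfold x in hlt. rewrite !(ln_termval_seg n) in hlt by auto. lra.
      - unfold termval at 1. rewrite <- Hc', Rmult_0_l. lra. }
    assert (Emx : termval x m = peval P x).
    { rewrite <- Etop. apply ln_inv; [exact Tmx|exact Tpx|].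
      unfold x. rewrite !(ln_termval_seg n); auto. lra. }
    apply (in_cell_nonzero A B q x Hcx). apply HV; [now apply inTpos_inTn|].
    right. exists m, p. repeat split; auto.
    (* With equal exponents the ratio of [m] to [p] would be constant, but [m] is at most [p] at [z]
       and above [p] at [w]. *)
    intros Eexp.
    assert (hz := peval_ub P z m Hm). rewrite <- Ep in hz.
    unfold termval in hz. rewrite Eexp in hz.
    destruct Wp as [_ Lp].
    assert (mz := monoval_pos n z (snd p) Hz Lp). assert (mw := monoval_pos n w (snd p) Hw Lp).
    apply Rmult_le_reg_r in hz; [|exact mz].
    assert (hw : termval w m <= termval w p).
    { unfold termval. rewrite Eexp. apply Rmult_le_compat_r; lra. }
    apply ln_le in hw; [lra|]. now apply (termval_pos n).
Qed.

(* The ray from [z] towards [x_s = 0] stays in the cell, so its endpoint is not a zero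
   of P; there P would vanish along p if p involved [X_s]. *)
Lemma cell_boundary s : nth s (snd q) 0%nat = 0%nat -> nth s (snd p) 0%nat = 0%nat.
Proof.
  intros Hq. destruct (nth s (snd p) 0%nat) as [|e] eqn:He; [reflexivity|]. exfalso.
  assert (Hc : forall t, 0 <= t <= 1 -> in_cell A B q (scale s t z)).
  { intros t Ht. unfold in_cell. rewrite termval_scale, Hq. simpl. rewrite Rmult_1_l.
    eapply Rle_lt_trans; [|exact Hcz]. apply peval_lub; [apply peval_nonneg|].
    intros m Hm. rewrite termval_scale.
    eapply Rle_trans; [|apply peval_ub, Hm].
    assert (h := termval_nonneg n z m (inTpos_inTn _ _ Hz) (cell_wf_other m Hm)).
    assert (h1 : t ^ nth s (snd m) 0%nat <= 1).
    { rewrite <- (pow1 (nth s (snd m) 0%nat)). apply pow_incr. lra. }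
    assert (h0 : 0 <= t ^ nth s (snd m) 0%nat) by (apply pow_le; lra).
    nra. }
  assert (Hd := cell_P_pos (scale s 0 z)
    (scale_inTn n s 0 z (Rle_refl 0) (inTpos_inTn _ _ Hz)) (Hc 0 ltac:(lra))).
  (* As [0 ^ 0 = 1], the terms free of [X_s] keep their value at the endpoint and the others vanish;
     positivity of P there yields a term [m] free of [X_s]. *)
  destruct (peval_attained _ _ Hd) as [m [Hm Em]]. rewrite <- Em in Hd. clear Em.
  rewrite termval_scale in Hd.
  destruct (nth s (snd m) 0%nat) as [|f] eqn:Hf; [|simpl in Hd; lra].
  simpl in Hd. rewrite Rmult_1_l in Hd.
  assert (Tp := termval_pos n z p Hz (wf_In _ _ _ HP Hp) cell_pos_p).
  (* Small enough that [p] drops to at most half of [m], whose value is constant on the ray, while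
     the point is still positive and in the cell. *)
  set (t := Rmin 1 (termval z m / (2 * termval z p))).
  assert (Ht0 : 0 < t).
  { apply Rmin_glb_lt; [lra|]. apply Rdiv_lt_0_compat; lra. }
  assert (Ht1 : t <= 1) by apply Rmin_l.
  assert (Ht2 : t * termval z p <= termval z m / 2).
  { replace (termval z m / 2) with (termval z m / (2 * termval z p) * termval z p)
      by (field; lra).
    apply Rmult_le_compat_r; [lra|apply Rmin_r]. }
  assert (H := cell_top_term (scale s t z) m (scale_pos n s t z Ht0 Hz) (Hc t ltac:(lra)) Hm).
  rewrite !termval_scale, Hf, He in H. simpl in H.
  assert (h1 : t ^ e <= 1).
  { rewrite <- (pow1 e). apply pow_incr. lra. }
  assert (h0 : 0 <= t ^ e) by (apply pow_le; lra).
  assert (t * t ^ e * termval z p <= t * termval z p).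
  { apply Rmult_le_compat_r; [lra|]. nra. }
  lra.
Qed.


(* [l > p] is infeasible inside the cell of q; Gordan's alternative turns this into
   [N (log l - log p) <= M (log Q - log q)], and [N > 0] because the cell is nonempty. *)
Lemma cell_term_bound l : In l P ->
  exists K, forall k, (K <= k)%nat -> forall x, inTpos n x ->
    termval x l * termval x q ^ k <= termval x p * peval Q x ^ k.
Proof.
  intros Hl. assert (Wl := wf_In _ _ _ HP Hl). assert (Wp := wf_In _ _ _ HP Hp).
  assert (Pp := cell_pos_p). assert (Wq := cell_wf_q). assert (Pq := cell_pos_q).
  destruct (Wl) as [[Cl|Cl] _].
  2:{ exists O. intros k _ x Hx. unfold termval at 1. rewrite <- Cl, !Rmult_0_l.
      apply Rmult_le_pos; [|apply pow_le, peval_nonneg].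
      apply (termval_nonneg n); auto using inTpos_inTn. }
  set (AB := positive_part (A ++ B)).
  assert (HAB := In_positive_part (A ++ B)). fold AB in HAB.
  (* A pair encodes the demand that its first term be smaller than its second: [l] beats [p], and
     [q] beats every other term of Q. *)
  set (rows := (p, l) :: map (fun m => (m, q)) AB).
  set (v := fun (c : (R * expo) * (R * expo)) i => (lexp (fst c) i - lexp (snd c) i)%Z).
  set (b := fun c : (R * expo) * (R * expo) => ln (fst (fst c)) - ln (fst (snd c))).
  set (val := fun x (c : (R * expo) * (R * expo)) =>
                ln (termval x (fst c)) - ln (termval x (snd c))).
  assert (Hval : forall x c, inTpos n x -> In c rows ->
            val x c = dot n (v c) (fun i => ln (x i)) + b c).
  { intros x c Hx Hc. unfold val, v, b. rewrite dot_minus.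
    assert (Hw : wfterm n (fst c) /\ 0 < fst (fst c) /\ wfterm n (snd c) /\ 0 < fst (snd c)).
    { destruct Hc as [<-|Hc]; [simpl; auto|].
      apply in_map_iff in Hc. destruct Hc as [m [<- Hm]]. apply HAB in Hm.
      simpl. destruct Hm. auto using cell_wf_other. }
    rewrite !(ln_termval n) by tauto. ring. }
  destruct (gordan n _ v b rows) as [[y Hy]|[L [Hnil [HL [HZ Hb]]]]].
  - exfalso. set (x := fun i => exp (y i)).
    assert (Hx : inTpos n x) by (intros i _; apply exp_pos).
    assert (Hneg : forall c, In c rows -> val x c < 0).
    { intros c Hc. rewrite Hval by auto.
      rewrite (dot_ext n _ (v c) _ y); [now apply Hy|reflexivity|].
      intros i _. unfold x. apply ln_exp. }
    assert (Hcx : in_cell A B q x).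
    { apply (in_cell_intro n); auto. intros m Hm Hc.
      assert (h : In (m, q) rows).
      { right. apply (in_map (fun m => (m, q))), HAB. auto. }
      apply Hneg in h. unfold val in h. simpl in h. lra. }
    assert (h1 := cell_top_term x l Hx Hcx Hl).
    apply ln_le in h1; [|now apply (termval_pos n)].
    assert (h2 := Hneg (p, l) (or_introl eq_refl)). unfold val in h2. simpl in h2. lra.
  - assert (HLx : forall x, inTpos n x -> 0 <= sumR (val x) L).
    { intros x Hx.
      rewrite (sumR_ext _ (fun c => dot n (v c) (fun i => ln (x i)) + b c)) by auto.
      rewrite sumR_plus, <- dot_sumZ.
      rewrite (dot_ext n _ (fun _ => 0%Z) _ (fun i => ln (x i))) by auto.
      rewrite dot_0. lra. }
    (* [N] and [M] count the two kinds of rows in [L]; each row [(m, q)] is at most log Q - log q.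
       Rows of the second kind are negative at [z], so a nonempty [L] without [(p, l)] would have a
       negative sum there. *)
    assert (Hcount : exists N M : nat,
       (forall x, inTpos n x -> sumR (val x) L <=
          INR N * val x (p, l) + INR M * (ln (peval Q x) - ln (termval x q))) /\
       (N = O -> L <> [] -> sumR (val z) L < 0)).
    { clear Hnil HZ Hb HLx. induction L as [|c L IH].
      - exists O, O. split; [intros; simpl; lra|congruence].
      - destruct IH as [N [M [H1 H2]]]; [intros a Ha; apply HL; now right|].
        destruct (HL c (or_introl eq_refl)) as [<-|Hc].
        + exists (S N), M. split; [|lia]. intros x Hx. specialize (H1 x Hx).
          rewrite S_INR. simpl. lra.
        + apply in_map_iff in Hc. destruct Hc as [m [<- Hm]]. apply HAB in Hm.
          destruct Hm as [Hm Cm]. assert (Wm := cell_wf_other m Hm).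
          exists N, (S M). split.
          * intros x Hx. specialize (H1 x Hx). rewrite S_INR. simpl. unfold val at 1. simpl.
            assert (h : ln (termval x m) <= ln (peval Q x)).
            { apply ln_le; [now apply (termval_pos n)|]. apply peval_ub.
              apply in_app_iff in Hm. apply in_app_iff. simpl. tauto. }
            lra.
          * intros HN _. simpl. unfold val at 1. simpl.
            assert (h : ln (termval z m) < ln (termval z q)).
            { apply ln_increasing; [now apply (termval_pos n)|].
              eapply Rle_lt_trans; [apply peval_ub, Hm|exact Hcz]. }
            destruct L as [|c L]; [simpl; lra|]. specialize (H2 HN ltac:(discriminate)). lra. }
    destruct Hcount as [N [M [H1 H2]]].
    destruct N as [|N].
    { specialize (H2 eq_refl Hnil). specialize (HLx z Hz). lra. }
    exists M. intros k Hk x Hx.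
    specialize (H1 x Hx). specialize (HLx x Hx). unfold val at 2 in H1. simpl fst in H1.
    simpl snd in H1.
    assert (Tl := termval_pos n x l Hx Wl Cl). assert (Tp := termval_pos n x p Hx Wp Pp).
    assert (Tq := termval_pos n x q Hx Wq Pq).
    assert (Hq : termval x q <= peval Q x) by (apply peval_ub, in_elt).
    assert (Lq := ln_le _ _ Tq Hq).
    assert (TQ : 0 < peval Q x) by lra.
    assert (Tqk := pow_lt _ k Tq). assert (TQk := pow_lt _ k TQ).
    apply Rnot_lt_le. intros hlt. apply ln_increasing in hlt; [|nra].
    rewrite !ln_mult, !ln_pow in hlt by auto.
    apply le_INR in Hk. rewrite S_INR in H1.
    assert (HN := pos_INR N). assert (HM := pos_INR M).
    set (u := ln (termval x l) - ln (termval x p)) in *.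
    set (d := ln (peval Q x) - ln (termval x q)) in *.
    assert (hu : INR k * d < u) by (unfold u, d; lra).
    assert (hd : 0 <= d) by (unfold d; lra).
    assert (hs : (INR N + 1) * u <= INR M * d) by (unfold u; lra).
    assert (0 <= INR k * d) by (apply Rmult_le_pos; lra).
    assert (INR M * d <= INR k * d) by (apply Rmult_le_compat_r; lra).
    nra.
Qed.

Lemma cell_poly_bound : exists K, forall k, (K <= k)%nat -> forall x, inTpos n x ->
  peval P x * termval x q ^ k <= termval x p * peval Q x ^ k.
Proof.
  assert (H : forall P', incl P' P -> exists K, forall k, (K <= k)%nat -> forall x,
    inTpos n x -> forall l, In l P' ->
    termval x l * termval x q ^ k <= termval x p * peval Q x ^ k).
  { induction P' as [|l P' IH]; intros HI.
    - exists O. intros ? ? ? ? ? [].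
    - destruct IH as [K1 H1]; [intros a Ha; apply HI; now right|].
      destruct (cell_term_bound l (HI l (or_introl eq_refl))) as [K2 H2].
      exists (max K1 K2). intros k Hk x Hx l' [<-|Hl'].
      + apply H2; [lia|exact Hx].
      + apply H1; [lia|exact Hx|exact Hl']. }
  destruct (H P (incl_refl P)) as [K HK]. exists K. intros k Hk x Hx.
  destruct (peval_nonneg P x) as [h|h].
  - destruct (peval_attained P x h) as [l [Hl <-]]. now apply HK.
  - rewrite <- h, Rmult_0_l. apply Rmult_le_pos; [|apply pow_le, peval_nonneg].
    apply (termval_nonneg n); auto using inTpos_inTn. now apply (wf_In n P).
Qed.

(** The truncated subtraction of exponents is exact: where [q] involves [X_s], it is enough that [k]
    is at least the largest exponent of [p]; elsewhere [p] is free of [X_s] by [cell_boundary]. *)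
Lemma cell_quotient : exists K, forall k, (K <= k)%nat -> exists r, wfterm n r /\
  forall x, inTpos n x -> termval x r * termval x p = termval x q ^ k.
Proof.
  assert (Wp := wf_In _ _ _ HP Hp).
  assert (Pp := cell_pos_p). assert (Wq := cell_wf_q). assert (Pq := cell_pos_q).
  exists (list_max (snd p)). intros k Hk.
  set (g := fun s => (k * nth s (snd q) 0 - nth s (snd p) 0)%nat).
  exists (fst q ^ k / fst p, map g (seq 0 n)).
  assert (Cr : 0 < fst q ^ k / fst p) by (apply Rdiv_lt_0_compat; [now apply pow_lt|exact Pp]).
  assert (Wr : wfterm n (fst q ^ k / fst p, map g (seq 0 n))).
  { split; simpl; [lra|]. now rewrite length_map, length_seq. }
  split; [exact Wr|]. intros x Hx.
  set (r := (fst q ^ k / fst p, map g (seq 0 n))) in *.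
  assert (Tr := termval_pos n x r Hx Wr Cr). assert (Tp := termval_pos n x p Hx Wp Pp).
  assert (Tq := termval_pos n x q Hx Wq Pq).
  apply ln_inv; [nra|now apply pow_lt|].
  rewrite ln_mult, ln_pow by auto.
  rewrite !(ln_termval n) by auto. simpl fst.
  unfold Rdiv. rewrite ln_mult, ln_Rinv, ln_pow;
    [|exact Pq|exact Pp|now apply pow_lt|now apply Rinv_0_lt_compat].
  assert (E : dot n (lexp r) (fun i => ln (x i)) + dot n (lexp p) (fun i => ln (x i))
              = INR k * dot n (lexp q) (fun i => ln (x i))).
  { rewrite <- dot_plus, <- (sumR_repeat (fun a => dot n (lexp a) (fun i => ln (x i)))), <- dot_sumZ.
    apply dot_ext; [|reflexivity]. intros s Hs. rewrite sumZ_repeat.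
    unfold lexp, r. simpl snd.
    rewrite (nth_indep _ 0%nat (g O)) by now rewrite length_map, length_seq.
    rewrite map_nth, seq_nth by exact Hs. unfold g. simpl.
    assert (Hle : (nth s (snd p) 0 <= k * nth s (snd q) 0)%nat).
    { destruct (nth s (snd q) 0%nat) as [|e] eqn:He; [rewrite cell_boundary by exact He; lia|].
      assert (h : (nth s (snd p) 0 <= list_max (snd p))%nat).
      { destruct (Nat.lt_ge_cases s (length (snd p))) as [h|h].
        - assert (hm := proj1 (list_max_le (snd p) _) (Nat.le_refl _)).
          rewrite Forall_forall in hm. apply hm, nth_In, h.
        - rewrite nth_overflow by exact h. lia. }
      nia. }
    lia. }
  lra.
Qed.

(** Take [r] to be q^k / p. The upper bound is [cell_poly_bound] divided by [p]; the lower one holds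
    because [p] is a term of P. *)
Lemma cell_factor : exists K, forall k, (K <= k)%nat -> exists r, wfterm n r /\
  forall x, inTpos n x -> termval x r * peval P x <= peval Q x ^ k /\
    termval x q ^ k <= termval x r * peval P x.
Proof.
  destruct cell_poly_bound as [K1 H1]. destruct cell_quotient as [K2 H2].
  exists (max K1 K2). intros k Hk. destruct (H2 k ltac:(lia)) as [r [Wr Hr]].
  exists r. split; [exact Wr|]. intros x Hx. specialize (Hr x Hx).
  specialize (H1 k ltac:(lia) x Hx).
  assert (Tp := termval_pos n x p Hx (wf_In _ _ _ HP Hp) cell_pos_p).
  assert (Nr := termval_nonneg n x r (inTpos_inTn _ _ Hx) Wr).
  split.
  - apply (Rmult_le_reg_l (termval x p)); [exact Tp|]. rewrite <- Hr in H1. lra.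
  - rewrite <- Hr. apply Rmult_le_compat_l; [exact Nr|]. now apply peval_ub.
Qed.

End Cell.

(** * Removing redundant terms and gluing the quotients of all cells *)

Lemma irredundant_subpoly n Q : exists Q', incl Q' Q /\
  (forall x, inTpos n x -> peval Q' x = peval Q x) /\
  (forall A q B, Q' = A ++ q :: B -> exists z, inTpos n z /\ in_cell A B q z).
Proof.
  remember (length Q) as d eqn:Hd. revert Q Hd.
  induction d as [d IH] using lt_wf_ind. intros Q Hd.
  destruct (classic (exists A q B, Q = A ++ q :: B /\
              ~ exists z, inTpos n z /\ in_cell A B q z)) as [[A [q [B [E H]]]]|H].
  (* A term with empty cell never strictly exceeds the maximum of the others, so deleting it
     preserves the function at positive points. *)
  - destruct (IH (length (A ++ B))) with (Q := A ++ B) as [Q' [I1 [I2 I3]]]; [|reflexivity|].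
    { subst. rewrite !length_app. simpl. lia. }
    assert (HI : incl (A ++ B) Q).
    { subst Q. intros a Ha. apply in_app_iff in Ha. apply in_app_iff. simpl. tauto. }
    exists Q'. split; [|split; [|exact I3]].
    + intros a Ha. auto.
    + intros x Hx. rewrite I2 by auto. apply Rle_antisym; [now apply peval_incl|].
      subst Q. apply peval_lub; [apply peval_nonneg|]. intros m Hm.
      apply in_app_iff in Hm. destruct Hm as [Hm|[<-|Hm]];
        try (apply peval_ub, in_app_iff; auto; fail).
      apply Rnot_lt_le. intros h. apply H. exists x. auto.
  - exists Q. repeat split.
    + apply incl_refl.
    + intros A q B E. apply NNPP. intros h. apply H. eauto 10.
Qed.

(** R collects the quotients of the cells one by one: a maximum of lower bounds for Q^k / P is again
    one, and each new quotient brings R P up to the corresponding q^k. *)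
Lemma irredundant_factor n P Q : wf n P -> wf n Q -> Vsub n P Q ->
  (forall A q B, Q = A ++ q :: B -> exists z, inTpos n z /\ in_cell A B q z) ->
  forall J, incl J Q -> exists K, forall k, (K <= k)%nat -> exists R, wf n R /\
    forall x, inTpos n x -> peval R x * peval P x <= peval Q x ^ k /\
      forall q, In q J -> termval x q ^ k <= peval R x * peval P x.
Proof.
  intros HP HQ HV Hcell. induction J as [|q J IH]; intros HJ.
  - exists O. intros k _. exists []. split; [constructor|]. intros x Hx. split.
    + unfold peval at 1. simpl. rewrite Rmult_0_l. apply pow_le, peval_nonneg.
    + intros q [].
  - destruct IH as [K1 H1]; [intros a Ha; apply HJ; now right|].
    destruct (in_split q Q (HJ q (or_introl eq_refl))) as [A [B E]]. subst Q.
    destruct (Hcell A q B eq_refl) as [z [Hz Hc]].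
    assert (HPz := cell_P_pos n P A B q HV z (inTpos_inTn _ _ Hz) Hc).
    destruct (peval_attained P z HPz) as [p [Hp Ep]].
    destruct (cell_factor n P A B q z p HP HQ HV Hz Hc Hp Ep) as [K2 H2].
    exists (max K1 K2). intros k Hk.
    destruct (H1 k ltac:(lia)) as [R [WR HR]]. destruct (H2 k ltac:(lia)) as [r [Wr Hr]].
    exists (r :: R). split; [now constructor|]. intros x Hx.
    destruct (HR x Hx) as [R1 R2]. destruct (Hr x Hx) as [r1 r2].
    assert (N := peval_nonneg P x).
    change (peval (r :: R) x) with (Rmax (termval x r) (peval R x)).
    rewrite Rmult_comm, <- RmaxRmult, !(Rmult_comm (peval P x)) by exact N. split.
    + now apply Rmax_lub.
    + intros q' [<-|Hq'].
      * eapply Rle_trans; [exact r2|apply Rmax_l].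
      * eapply Rle_trans; [now apply R2|apply Rmax_r].
Qed.

Lemma Vsub_eval_factor n P Q : wf n P -> wf n Q -> Vsub n P Q ->
  exists k R, (1 <= k)%nat /\ wf n R /\
    forall x, inTpos n x -> peval Q x ^ k = peval P x * peval R x.
Proof.
  intros HP HQ HV.
  destruct (irredundant_subpoly n Q) as [Q' [HI [HE Hcell]]].
  assert (HQ' : wf n Q') by (eapply incl_Forall; eauto).
  assert (HV' : Vsub n P Q').
  { assert (h : Vsub n Q Q').
    { apply (eval_factor_Vsub n Q Q' (pone n) 1); auto using wf_pone.
      intros x Hx. rewrite peval_pone, HE by auto. ring. }
    intros x Hx Hz. auto. }
  destruct (irredundant_factor n P Q' HP HQ' HV' Hcell Q' (incl_refl _)) as [K HK].
  (* [S K] instead of [K] makes the exponent at least one. *)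
  destruct (HK (S K) ltac:(lia)) as [R [WR HR]].
  exists (S K), R. split; [lia|]. split; [exact WR|]. intros x Hx.
  destruct (HR x Hx) as [H1 H2]. rewrite <- HE by auto.
  apply Rle_antisym; [|lra].
  destruct (peval_nonneg Q' x) as [h|h].
  - destruct (peval_attained Q' x h) as [q [Hq <-]]. rewrite Rmult_comm. now apply H2.
  - rewrite <- h. simpl. rewrite Rmult_0_l. apply Rmult_le_pos; apply peval_nonneg.
Qed.

Theorem theorem3p10 (n : nat) (P Q : tpoly) (hP : wf n P) (hQ : wf n Q) :
  Vsub n P Q <-> exists k : nat, (1 <= k)%nat /\ tdivides n P (ppow n Q k).
Proof.
  split.
  - intros HV. destruct (Vsub_eval_factor n P Q hP hQ HV) as [k [R [Hk [WR HR]]]].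
    exists k. split; [exact Hk|]. exists R. split; [exact WR|].
    (* Equality of functions at positive points provides the multiplier [U] that [tdivides] asks
       for. *)
    apply eval_eq_cancel; auto using wf_ppow, wf_pmul.
    intros x Hx. assert (Hx' := inTpos_inTn n x Hx).
    rewrite (peval_ppow n), (peval_pmul n) by auto. now apply HR.
  - intros [k [_ Hd]].
    destruct (tdivides_eval n P (ppow n Q k) hP (wf_ppow n Q k hQ) Hd) as [R [WR HR]].
    apply (eval_factor_Vsub n P Q R k); auto.
    intros x Hx. rewrite <- (peval_ppow n) by auto using inTpos_inTn. now apply HR.
Qed.
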